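(* There exist absolute constants $\alpha, \beta, \gamma, \eta, C > 0$ such that for every constant $c > 0$ there are constants $C_1, C_2, \eta' > 0$ (depending only on $c$) with the following property. Let $n, p \ge 1$, $b \ge 0$, and $\varepsilon, \delta$ with $p^{-1/3} \le \varepsilon \le 1/2$, $\alpha e^{-\beta\varepsilon^2 p} \le \delta < 1$ and $1/\delta \in \mathbb{N}$. Consider the renormalized multi-processor cup game with parameters $p,\varepsilon,\delta$ on $n$ cups, starting from a state in which $b$ units of water have been dispersed arbitrarily among the cups, with the emptier using the multi-processor smoothed greedy algorithm where each counter $w_j$ is initialized to the number of thresholds of cup $j$ that are at most the initial amount of water in cup $j$. Then for every oblivious filler and every step $i$ with $i \ge \delta^{-8} p^2$ and $i \ge 2b/\delta$: (1) the backlog after step $i$ is at most $3$ with probability at least $1 - C e^{-\gamma \varepsilon^2 p} - C e^{-\eta i^{1/6}}$; (2) if moreover $\delta \ge p^{-c}$, then for every real $k \ge \log p$ the backlog after step $i$ is at most $C_1 k/\varepsilon$ with probability at least $1 - C_2 e^{-e^k} - C_2 e^{-\eta' i^{1/6}}$.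
   Context: Renormalized multi-processor cup game with parameters $p,\varepsilon,\delta$: $n$ cups; in each step the filler pours nonnegative amounts $c_j(i) \le 1$ with $\sum_j c_j(i) \le (1-\varepsilon)p$, then the emptier selects up to $p+1$ distinct cups and removes up to $1+2\delta$ units from each. The filler is oblivious (amounts fixed in advance, independent of the emptier's randomness). The backlog after a step is the maximum fill of any cup. Thresholds (for $1/\delta = D \in \mathbb{N}$): for each cup $j$ and each integer $i \ge 1$ with $i \equiv 1 \pmod{D+1}$, draw an independent uniform $s_j(i) \in (0,1]$; the thresholds of cup $j$ are all numbers $(i+t)+s_j(i)$, $t=1,\dots,D$, over all such $i$. Let $a_j(0)$ be the initial amount of water in cup $j$ and $a_j(i)$ equal $a_j(0)$ plus the total water poured into cup $j$ during the first $i$ steps. Cup $j$ crosses threshold $x$ in step $i$ if $a_j(i-1) < x \le a_j(i)$. Multi-processor smoothed greedy algorithm: each cup has a counter $w_j$ (initialized as specified in the claim). In each step, after the filler pours, $w_j$ increases by $1+\delta$ for each threshold of cup $j$ crossed in that step. The emptier selects up to $p+1$ distinct cups, giving priority to cups with $w_j \ge 1+\delta$ over all others and to cups with $w_j \neq 0$ over cups with $w_j = 0$; within each priority level it selects the fullest cups. From each selected cup $j$ it removes $t_j = \min(1+2\delta, w_j)$ units and sets $w_j \leftarrow w_j - t_j$.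
   Formalization: Each counter w_j is initialized to (1+δ) times the number of thresholds of cup j at most its initial water, not to that number itself; with weight 1 a cup initially holding b units would keep at least bδ/(1+δ) units forever if nothing is poured, so the claim would fail for large b. *)

(* Defs.v *)
From mathcomp Require Import all_boot all_order all_algebra finmap.
From mathcomp Require Import all_classical all_reals all_analysis.
Set Implicit Arguments.
Unset Strict Implicit.
Unset Printing Implicit Defensive.
Import Order.TTheory GRing.Theory Num.Theory.
Local Open Scope classical_set_scope.
Local Open Scope ring_scope.

Definition mutually_independent d (T : measurableType d) (R : realType)
    (P : probability T R) (I : eqType) (A : set I) (X : I -> {RV P >-> R}) :
    Prop :=
  forall (r : seq I) (B : I -> set R),
    uniq r -> (forall k, k \in r -> A k) -> (forall k, measurable (B k)) ->
    P [set x | forall k, k \in r -> B k (X k x)] =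
    (\prod_(k <- r) P (X k @^-1` B k))%E.

(* Equivalent to [q <= P A] when [A] is measurable; the inner approximation
   avoids having to restrict the emptier to measurable tie-breaking rules. *)
Definition prob_at_least d (T : measurableType d) (R : realType)
    (P : probability T R) (A : set T) (q : R) : Prop :=
  exists E : set T, [/\ measurable E, E `<=` A & (q%:E <= P E)%E].

Definition block_start (D i : nat) : Prop :=
  (0 < i)%N /\ i = 1 %[mod D.+1].

(* [s j i] is only meaningful when [block_start D i]; the other variables of
   the family are unconstrained and never used. *)
Definition uniform_draws d (T : measurableType d) (R : realType)
    (P : probability T R) (n D : nat) (s : 'I_n -> nat -> {RV P >-> R}) :
    Prop :=
  [/\ forall j i x, block_start D i -> 0 < s j i x <= 1,
      forall j i (B : set R), block_start D i -> measurable B ->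
        distribution P (s j i) B = uniform_prob (@ltr01 R) B &
      mutually_independent [set ji : 'I_n * nat | block_start D ji.2]
        (fun ji => s ji.1 ji.2)].

Definition thresholds (R : realType) (D : nat) (sj : nat -> R) : set R :=
  [set x | exists i t : nat,
     [/\ block_start D i, (1 <= t <= D)%N & x = (i + t)%:R + sj i]].

(* The sets counted below are finite: consecutive thresholds of a cup are at
   distance at least 1. *)
Definition nb_thresholds_le (R : realType) (D : nat) (sj : nat -> R) (a : R) :
    nat :=
  #|` fset_set (thresholds D sj `&` [set x | x <= a]) |.

Definition nb_crossed (R : realType) (D : nat) (sj : nat -> R) (a a' : R) :
    nat :=
  #|` fset_set (thresholds D sj `&` [set x | a < x <= a']) |.

(* Amounts fixed in advance; steps are numbered from 1. *)
Definition filler (R : realType) (n p : nat) (eps : R)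
    (c : nat -> 'I_n -> R) : Prop :=
  forall i, (0 < i)%N ->
    (forall j, 0 <= c i j <= 1) /\ \sum_j c i j <= (1 - eps) * p%:R.

Definition initial_water (R : realType) (n : nat) (b : R) (a0 : 'I_n -> R) :
    Prop :=
  (forall j, 0 <= a0 j) /\ \sum_j a0 j = b.

Definition poured (R : realType) (n : nat) (a0 : 'I_n -> R)
    (c : nat -> 'I_n -> R) (i : nat) (j : 'I_n) : R :=
  a0 j + \sum_(1 <= m < i.+1) c m j.

Definition priority (R : realType) (delta w : R) : nat :=
  if 1 + delta <= w then 2 else if w != 0 then 1 else 0.

Definition greedy_choice (R : realType) (n p : nat) (delta : R)
    (fill counter : 'I_n -> R) (S : {set 'I_n}) : Prop :=
  #|S| = minn p.+1 n /\
  forall j k, j \in S -> k \notin S ->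
    (priority delta (counter k) < priority delta (counter j))%N \/
    (priority delta (counter k) = priority delta (counter j) /\
     fill k <= fill j).

(* The algorithm does not say how ties between equally full cups are broken:
   a selection rule is any function of the step number and of the state of the
   cups after the filler has poured that makes greedy choices. *)
Definition greedy_rule (R : realType) (n p : nat) (delta : R)
    (sel : nat -> ('I_n -> R) -> ('I_n -> R) -> {set 'I_n}) : Prop :=
  forall i fill counter,
    greedy_choice p delta fill counter (sel i fill counter).

Record state (R : realType) (n : nat) :=
  State { fill : 'I_n -> R ; counter : 'I_n -> R }.

(* Every threshold counts for [1 + delta], whether it is passed by the initial
   water or by water poured later: with weight 1 for the initial thresholds, a
   cup holding [a] units initially would keep at least
   [a * delta / (1 + delta)] units forever. *)
Definition init_state (R : realType) (n D : nat) (delta : R)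
    (s : 'I_n -> nat -> R) (a0 : 'I_n -> R) : state R n :=
  State a0 (fun j => (1 + delta) * (nb_thresholds_le D (s j) (a0 j))%:R).

Definition next_state (R : realType) (n D : nat) (delta : R)
    (s : 'I_n -> nat -> R) (a0 : 'I_n -> R) (c : nat -> 'I_n -> R)
    (sel : nat -> ('I_n -> R) -> ('I_n -> R) -> {set 'I_n})
    (i : nat) (st : state R n) : state R n :=
  let f j := fill st j + c i j in
  let w j := counter st j + (1 + delta) *
    (nb_crossed D (s j) (poured a0 c i.-1 j) (poured a0 c i j))%:R in
  let S := sel i f w in
  let t j := if j \in S then Num.min (1 + 2 * delta) (w j) else 0 in
  State (fun j => f j - t j) (fun j => w j - t j).

Fixpoint state_after (R : realType) (n D : nat) (delta : R)
    (s : 'I_n -> nat -> R) (a0 : 'I_n -> R) (c : nat -> 'I_n -> R)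
    (sel : nat -> ('I_n -> R) -> ('I_n -> R) -> {set 'I_n})
    (i : nat) : state R n :=
  if i is i'.+1 then
    next_state D delta s a0 c sel i (state_after D delta s a0 c sel i')
  else init_state D delta s a0.

(* Fills are nonnegative, so 0 is a neutral base for the maximum. *)
Definition backlog (R : realType) (n : nat) (st : state R n) : R :=
  \big[Num.max/0]_(j < n) fill st j.

(* Main.v *)
(* Let [X m] be the number of thresholds crossed at step [m]. For each cup the
   fill exceeds the counter by an amount in [[0, 3]], and the counters are
   multiples of [delta], so their sum divided by [delta] is an integer [U m] with
   [U (m + 1) <= (U m - 1) + (D + 1) (X (m + 1) - p)], both differences being
   truncated: a queue which loses a unit per step and grows only when more than
   [p] thresholds are crossed.

   [X m] is a sum of independent indicators of total mean at most
   [(1 - eps) p], so by Chernoff's bound the mean growth is exponentially small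
   in [eps^2 p]. The total growth over a window of [t] steps is a function of
   the independent draws in which one draw matters only if its block is crossed;
   a Bernstein bound, obtained by averaging out the draws one at a time, shows
   that it reaches [t / 2] with probability at most [exp (- t / Q)], where
   [Q = 4096 D^4 p]. Hence, except with probability
   [(Q + 1) exp (- L / Q) + exp (- i / Q)], the queue was empty at one of the
   last [L] steps (the last term accounts for the initial water).

   For (1), take [L] close to [Q p]: with high probability [X m <= p] during the
   last [L] steps, so the queue remains empty and all fills are at most 3.

   For (2), take [L] close to [2 Q exp k]. The pouring itself is deterministic
   and leaves room for [eps p] units per step, so the potential
   [\sum_j max 0 (exp (eps (f_j - 5) / 2) - 1)], where [f_j] is the fill of cup
   [j], grows by at most [p] per step: cups filled above 5 have top priority, and
   the fullest of them are emptied. It is 0 when the queue is empty, so it is at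
   most [L p] at the end, and the backlog is at most
   [5 + (2 / eps) ln (1 + L p)]. *)

Require Import Defs.
From mathcomp Require Import all_boot all_order all_algebra finmap.
From mathcomp Require Import all_classical all_reals all_analysis.
From mathcomp Require Import ring lra zify.
Set Implicit Arguments.
Unset Strict Implicit.
Unset Printing Implicit Defensive.
Import Order.TTheory GRing.Theory Num.Theory.
Local Open Scope classical_set_scope.
Local Open Scope ring_scope.

(** * Concentration on finite product spaces *)

Section ExpBounds.
Context {R : realType}.
Implicit Types x y : R.

(** From [1 - x <= expR (- x)] comes [expR x <= 1 / (1 - x)], and [(1 + x + 2 x^2) (1 - x) = 1 + x^2
    (1 - 2 x)] is at least 1. Negative [x] are included, as deviations of both signs occur later. *)
Lemma expR_le_quadratic x : x <= 1 / 2 -> expR x <= 1 + x + 2 * x ^+ 2.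
Proof.
move=> x2.
have h : 0 < 1 - x by lra.
have e1 : 1 - x <= expR (- x) by have := expR_ge1Dx (- x); lra.
have e0 : 0 < expR x := expR_gt0 x.
have e2 : expR x * (1 - x) <= 1.
  rewrite -[leRHS](mulfV (lt0r_neq0 e0)) -expRN.
  by rewrite ler_pM2l.
rewrite -(ler_pM2r h); apply: le_trans e2 _.
have -> : (1 + x + 2 * x ^+ 2) * (1 - x) = 1 + x ^+ 2 * (1 - 2 * x) by ring.
by rewrite lerDl mulr_ge0 ?sqr_ge0//; lra.
Qed.

Lemma expR_ge_lin x : x <= expR x.
Proof. by have := expR_ge1Dx x; lra. Qed.

Lemma geometric_tail_le (rho : R) (L m : nat) : 0 <= rho < 1 ->
  \sum_(L <= t < m) rho ^+ t <= rho ^+ L / (1 - rho).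
Proof.
case/andP=> r0 r1; rewrite ler_pdivlMr ?subr_gt0//.
case: (leqP m L) => [mL|/ltnW Lm].
  by rewrite big_geq// mul0r exprn_ge0.
rewrite mulr_suml (eq_bigr (fun t => - (rho ^+ t.+1 - rho ^+ t))); last first.
  by move=> t _; rewrite exprS; ring.
rewrite sumrN telescope_sumr// opprB lerBlDr lerDl exprn_ge0//.
Qed.

End ExpBounds.

(** * Exponential moments of functions of independent finite-valued coordinates *)

Section ProductSpace.
Context {R : realType} {K V : finType} (mu : K -> V -> R).
Hypothesis mu_ge0 : forall k v, 0 <= mu k v.
Hypothesis mu_sum1 : forall k, \sum_v mu k v = 1.

Definition weight (w : {ffun K -> V}) : R := \prod_k mu k (w k).

Definition expect (f : {ffun K -> V} -> R) : R := \sum_w weight w * f w.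

Lemma weight_ge0 w : 0 <= weight w.
Proof. by apply: prodr_ge0. Qed.

Lemma expect_prod (g : K -> V -> R) :
  expect (fun w => \prod_k g k (w k)) = \prod_k \sum_v mu k v * g k v.
Proof.
by rewrite bigA_distr_bigA; apply: eq_bigr => w _; rewrite -big_split.
Qed.

Lemma expect_cst (c : R) : expect (fun=> c) = c.
Proof.
have -> : expect (fun=> c) = expect (fun w => \prod_k (fun _ _ => 1) k (w k)) * c.
  by rewrite /expect mulr_suml; apply: eq_bigr => w _; rewrite big1// mulr1.
rewrite (expect_prod (fun _ _ => 1)) big1 ?mul1r// => k _.
by rewrite -[RHS](mu_sum1 k); apply: eq_bigr => v _; rewrite mulr1.
Qed.

Lemma le_expect f g : (forall w, f w <= g w) -> expect f <= expect g.
Proof. by move=> fg; apply: ler_sum => w _; rewrite ler_wpM2l// weight_ge0. Qed.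

Lemma expectD f g : expect (fun w => f w + g w) = expect f + expect g.
Proof. by rewrite -big_split; apply: eq_bigr => w _; rewrite mulrDr. Qed.

Lemma expectZ c f : expect (fun w => c * f w) = c * expect f.
Proof. by rewrite mulr_sumr; apply: eq_bigr => w _; rewrite mulrCA. Qed.

Lemma expect_sum I (r : seq I) (Q : pred I) (F : I -> {ffun K -> V} -> R) :
  expect (fun w => \sum_(i <- r | Q i) F i w) = \sum_(i <- r | Q i) expect (F i).
Proof.
by rewrite exchange_big /=; apply: eq_bigr => w _; rewrite mulr_sumr.
Qed.

Definition upd (w : {ffun K -> V}) k v : {ffun K -> V} :=
  [ffun l => if l == k then v else w l].

(** The conditional expectation of [f] given all coordinates other than [k]. *)
Definition avg k (f : {ffun K -> V} -> R) w : R :=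
  \sum_v mu k v * f (upd w k v).

Lemma updC w k l v u : k != l -> upd (upd w k v) l u = upd (upd w l u) k v.
Proof.
move=> kl; apply/ffunP => m; rewrite !ffunE.
case: (eqVneq m l) => // ->; case: (eqVneq l k) => // lk.
by rewrite lk eqxx in kl.
Qed.

Lemma upd_upd w k v u : upd (upd w k v) k u = upd w k u.
Proof. by apply/ffunP => m; rewrite !ffunE; case: eqP. Qed.

Lemma upd_id w k : upd w k (w k) = w.
Proof. by apply/ffunP => m; rewrite !ffunE; case: eqP => // ->. Qed.

Lemma weight_upd w k v : weight w * mu k v = weight (upd w k v) * mu k (w k).
Proof.
rewrite /weight (bigD1 k)//= [in RHS](bigD1 k)//= ffunE eqxx.
rewrite [X in _ = _ * X * _](eq_bigr (fun l => mu l (w l))); first by ring.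
by move=> l lk; rewrite ffunE (negbTE lk).
Qed.

(** Resampling: exchanging the coordinate [k] of [w] with an independent copy [v] is an involution
    which preserves the product measure. *)
Lemma expect_avg k f : expect (avg k f) = expect f.
Proof.
pose G (x : {ffun K -> V} * V) := weight x.1 * mu k x.2 * f x.1.
pose h (x : {ffun K -> V} * V) := (upd x.1 k x.2, x.1 k).
have hK : involutive h.
  by case=> w v; rewrite /h /= upd_upd upd_id ffunE eqxx.
transitivity (\sum_x G (h x)).
  rewrite -(pair_bigA _ (fun w v => G (h (w, v)))); apply: eq_bigr => w _.
  rewrite mulr_sumr; apply: eq_bigr => v _.
  by rewrite /G/= mulrA weight_upd.
rewrite (_ : \sum_x G (h x) = \sum_x G x); last by rewrite [RHS](reindex_inj (inv_inj hK)).
rewrite -(pair_bigA _ (fun w v => G (w, v))).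
apply: eq_bigr => w _; rewrite /G/= -mulr_suml -mulr_sumr mu_sum1.
by rewrite mulr1.
Qed.

(** [g k] marks the values of coordinate [k] that can influence [f]. A change between two unmarked
    values has no effect, so the variance due to [k] is proportional to the probability of [g k]. *)
Definition coord_lipschitz (c : R) (g : K -> pred V) (f : {ffun K -> V} -> R) :=
  forall k w v u, `|f (upd w k v) - f (upd w k u)| <= c *+ (g k v || g k u).

Lemma coord_lipschitz_avg c g l f : coord_lipschitz c g f -> coord_lipschitz c g (avg l f).
Proof.
move=> lf k w v u.
rewrite /avg -sumrB (le_trans (ler_norm_sum _ _ _))//.
have c0 : 0 <= c *+ (g k v || g k u) := le_trans (normr_ge0 _) (lf k w v u).
rewrite -[leRHS]mul1r -(mu_sum1 l) mulr_suml; apply: ler_sum => x _.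
rewrite -mulrBr normrM ger0_norm// ler_wpM2l//.
case: (eqVneq k l) => [<-|kl]; first by rewrite !upd_upd subrr normr0.
by rewrite !(@updC w k l)//.
Qed.

Definition avgs ks f := foldr avg f ks.

Lemma coord_lipschitz_avgs c g ks f : coord_lipschitz c g f -> coord_lipschitz c g (avgs ks f).
Proof. by move=> lf; elim: ks => //= k ks; exact: coord_lipschitz_avg. Qed.

Lemma avgs_const (ks : seq K) f (w w' : {ffun K -> V}) : (forall l, l \notin ks -> w l = w' l) ->
  avgs ks f w = avgs ks f w'.
Proof.
elim: ks w w' => [|k ks IH] w w' ww' /=.
  by congr f; apply/ffunP => l; exact: ww'.
apply: eq_bigr => v _; congr *%R; apply: IH => l lks; rewrite !ffunE.
by case: eqVneq => // lk; apply: ww'; rewrite inE negb_or lk.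
Qed.

Lemma expect_avgs ks f : expect (avgs ks f) = expect f.
Proof. by elim: ks => //= k ks; rewrite expect_avg. Qed.

(* The deviation [f - avg k f] in coordinate [k] is at most [c] and has variance
   at most [2 c^2 q]. *)
Lemma avg_expR_le c g q lam k f w :
  coord_lipschitz c g f -> \sum_v mu k v *+ g k v <= q ->
  0 <= c -> 0 <= lam -> lam * c <= 1 / 2 ->
  avg k (fun w => expR (lam * f w)) w <=
  expR (lam * avg k f w) * expR (4 * lam ^+ 2 * c ^+ 2 * q).
Proof.
move=> lf gq c0 l0 lc.
pose m := avg k f w; pose F v := f (upd w k v).
have q0 : 0 <= q by apply: le_trans gq; apply: sumr_ge0 => v _; rewrite mulrn_wge0.
(* The deviation is an average of differences, each controlled by the Lipschitz condition. *)
have FmE v : F v - m = \sum_u mu k u * (F v - F u).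
  rewrite /m /avg -[F v in LHS]mul1r -(mu_sum1 k) mulr_suml -sumrB.
  by apply: eq_bigr => u _; rewrite mulrBr.
have dev v : `|F v - m| <= \sum_u mu k u * `|F v - F u|.
  rewrite FmE (le_trans (ler_norm_sum _ _ _))//; apply: ler_sum => u _.
  by rewrite normrM ger0_norm.
have dev1 v : `|F v - m| <= c.
  apply: le_trans (dev v) _; rewrite -[leRHS]mul1r -(mu_sum1 k) mulr_suml.
  apply: ler_sum => u _; rewrite ler_wpM2l//; apply: le_trans (lf _ _ _ _) _.
  by case: (_ || _); rewrite ?mulr1n ?mulr0n.
(* Multiplied by the bound [c] of [dev1], this bounds the squared deviation by [c^2 (g k v + q)], of
   mean at most [2 c^2 q]. *)
have dev2 v : `|F v - m| <= c * ((g k v)%:R + q).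
  apply: le_trans (dev v) _.
  apply: (@le_trans _ _ (c * \sum_u mu k u * ((g k v)%:R + (g k u)%:R))).
    rewrite mulr_sumr; apply: ler_sum => u _; rewrite mulrCA ler_wpM2l//.
    apply: le_trans (lf _ _ _ _) _.
    by case: (g k v); case: (g k u); rewrite /= ?mulr1n ?mulr0n; lra.
  rewrite ler_wpM2l//; under eq_bigr do rewrite mulrDr.
  rewrite big_split/= -mulr_suml mu_sum1 mul1r lerD2l.
  by apply: le_trans gq; apply: ler_sum => u _; rewrite mulr_natr.
have key v : expR (lam * F v) <=
    expR (lam * m) * (1 + lam * (F v - m) + 2 * lam ^+ 2 * c ^+ 2 * ((g k v)%:R + q)).
  have -> : lam * F v = lam * m + lam * (F v - m) by ring.
  rewrite expRD ler_wpM2l ?expR_ge0//.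
apply: le_trans (expR_le_quadratic _) _.
    apply: le_trans lc; rewrite ler_wpM2l//.
    by apply: le_trans (dev1 v); exact: ler_norm.
  have h2 : (F v - m) ^+ 2 <= c ^+ 2 * ((g k v)%:R + q).
    rewrite -real_normK ?num_real// expr2 [c ^+ 2]expr2 -mulrA.
    by apply: ler_pM.
  have l2 : 0 <= 2 * lam ^+ 2 by rewrite mulr_ge0// sqr_ge0.
  by have := ler_wpM2l l2 h2; rewrite lerD2l exprMn !mulrA.
apply: le_trans (ler_sum _ (fun v _ => ler_wpM2l (mu_ge0 k v) (key v))) _.
under eq_bigr do rewrite mulrCA.
rewrite -mulr_sumr ler_wpM2l ?expR_ge0//.
apply: le_trans (expR_ge1Dx _).
have -> : \sum_v mu k v * (1 + lam * (F v - m) + 2 * lam ^+ 2 * c ^+ 2 * ((g k v)%:R + q))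
  = 1 + lam * (\sum_v mu k v * (F v - m)) +
    2 * lam ^+ 2 * c ^+ 2 * (\sum_v mu k v *+ g k v + q).
  rewrite (eq_bigr (fun v => mu k v + lam * (mu k v * (F v - m)) +
    2 * lam ^+ 2 * c ^+ 2 * (mu k v *+ g k v) + 2 * lam ^+ 2 * c ^+ 2 * q * mu k v)).
    by rewrite !big_split/= -!mulr_sumr mu_sum1; ring.
  by move=> v _; rewrite -mulr_natr; ring.
(* The linear term averages out since [m] is the mean of [F]. *)
have -> : \sum_v mu k v * (F v - m) = 0.
  under eq_bigr do rewrite mulrBr.
  by rewrite sumrB -mulr_suml mu_sum1 mul1r /m /avg subrr.
rewrite mulr0 addr0 lerD2l.
have h : 0 <= 2 * lam ^+ 2 * c ^+ 2 by rewrite !mulr_ge0// sqr_ge0.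
have := ler_wpM2l h gq; lra.
Qed.

(** Each coordinate averaged out costs a factor [expR (4 lam^2 c^2 q k)]; the averaged function
    keeps the same Lipschitz condition, so the one-coordinate bound can be iterated. *)
Lemma expect_expR_avgs c g (q : K -> R) lam ks f :
  coord_lipschitz c g f -> (forall k, \sum_v mu k v *+ g k v <= q k) ->
  0 <= c -> 0 <= lam -> lam * c <= 1 / 2 ->
  expect (fun w => expR (lam * f w)) <=
  expect (fun w => expR (lam * avgs ks f w)) *
    expR (4 * lam ^+ 2 * c ^+ 2 * \sum_(k <- ks) q k).
Proof.
move=> lf gq c0 l0 lc; elim: ks => [|k ks IH] /=.
  by rewrite big_nil mulr0 expR0 mulr1.
apply: le_trans IH _; rewrite big_cons mulrDr expRD mulrA.
rewrite ler_wpM2r ?expR_ge0// -(expect_avg k) mulrC -expectZ.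
apply: le_expect => w; rewrite mulrC.
by apply: (@avg_expR_le c g) => //; exact: coord_lipschitz_avgs.
Qed.

(** Once all coordinates are averaged out, the function is the constant [expect f]. *)
Lemma expect_expR_le c g (q : K -> R) lam f :
  coord_lipschitz c g f -> (forall k, \sum_v mu k v *+ g k v <= q k) ->
  0 <= c -> 0 <= lam -> lam * c <= 1 / 2 ->
  expect (fun w => expR (lam * f w)) <=
  expR (lam * expect f + 4 * lam ^+ 2 * c ^+ 2 * \sum_k q k).
Proof.
move=> lf gq c0 l0 lc.
have := @expect_expR_avgs c g q lam (enum K) f lf gq c0 l0 lc.
have -> : expect (fun w => expR (lam * avgs (enum K) f w)) = expR (lam * expect f).
  rewrite -[RHS]expect_cst; apply: eq_bigr => w _; congr (_ * expR (_ * _)).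
  rewrite -(expect_avgs (enum K)) -[LHS]expect_cst; apply: eq_bigr => w' _.
  by congr *%R; apply: avgs_const => l; rewrite mem_enum.
by rewrite -expRD big_enum.
Qed.

Definition prob (A : pred {ffun K -> V}) : R := expect (fun w => (A w)%:R).

Lemma prob_le_expect (A : pred {ffun K -> V}) f : (forall w, 0 <= f w) -> (forall w, A w -> 1 <= f w) ->
  prob A <= expect f.
Proof.
by move=> f0 fA; apply: le_expect => w; case: (boolP (A w)) => // /fA.
Qed.

Lemma prob_setC (A : pred {ffun K -> V}) : prob (fun w => ~~ A w) = 1 - prob A.
Proof.
apply/eqP; rewrite eq_sym subr_eq /prob -expectD -[X in X == _](expect_cst 1).
apply/eqP; apply: eq_bigr => w _; congr *%R.
by case: (A w); rewrite /= ?addr0 ?add0r.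
Qed.

End ProductSpace.

(** * Numbers of crossings per step and their excess over [p] *)

Section CrossingCounts.
Context {R : realType} {K V M : finType} (mu : K -> V -> R).
Hypothesis mu_ge0 : forall k v, 0 <= mu k v.
Hypothesis mu_sum1 : forall k, \sum_v mu k v = 1.
Variables (xi : K -> V -> pred M) (D p : nat) (eps : R).
Hypotheses (D_gt0 : (0 < D)%N) (p_gt0 : (0 < p)%N).
Hypotheses (eps_gt0 : 0 < eps) (eps_le : eps <= 1 / 2).
Hypothesis xi_sum : forall k v, (\sum_m xi k v m <= D)%N.
Hypothesis xi_mean : forall m,
  \sum_k \sum_v mu k v *+ xi k v m <= (1 - eps) * p%:R.

Definition crossings m (w : {ffun K -> V}) : nat := \sum_k xi k (w k) m.

(** By independence the moment is a product of factors [1 + (expR lam - 1) q], with [q] the crossing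
    probability of one draw; then [1 + x <= expR x]. *)
Lemma crossings_mgf m lam : 0 <= lam ->
  expect mu (fun w => expR (lam * (crossings m w)%:R)) <=
  expR ((expR lam - 1) * ((1 - eps) * p%:R)).
Proof.
move=> l0.
have e1 : 0 <= expR lam - 1 by have := expR_ge1Dx lam; lra.
have -> : expect mu (fun w => expR (lam * (crossings m w)%:R)) =
    expect mu (fun w => \prod_k (fun k v => expR (lam *+ xi k v m)) k (w k)).
  apply: eq_bigr => w _; congr *%R.
  rewrite /crossings natr_sum mulr_sumr expR_sum; apply: eq_bigr => k _.
  by rewrite mulr_natr.
rewrite (expect_prod mu (fun k v => expR (lam *+ xi k v m))).
apply: (@le_trans _ _ (\prod_k expR ((expR lam - 1) * \sum_v mu k v *+ xi k v m))).
  apply: ler_prod => k _; apply/andP; split.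
    by apply: sumr_ge0 => v _; rewrite mulr_ge0// expR_ge0.
  apply: le_trans (expR_ge1Dx _).
  rewrite -[X in X + _](mu_sum1 k) mulr_sumr -big_split/=.
  apply: ler_sum => v _; case: (xi k v m); rewrite ?mulr1n ?mulr0n ?expR0 ?mulr1 ?mulr0 ?addr0//.
  by rewrite mulrBl mul1r addrC subrK mulrC.
by rewrite -expR_sum -mulr_sumr ler_expR ler_wpM2l.
Qed.

(** Chernoff's bound with parameter [eps / 4]: the exponent per unit of [p] is at most [(eps / 4 +
    eps^2 / 8) (1 - eps) - eps / 4 = - eps^2 / 8 - eps^3 / 8]. *)
Lemma crossings_excess_mgf m :
  expect mu (fun w => expR (eps / 4 * ((crossings m w)%:R - p%:R))) <=
  expR (- (eps ^+ 2 * p%:R / 8)).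
Proof.
have -> : expect mu (fun w => expR (eps / 4 * ((crossings m w)%:R - p%:R))) =
    expR (- (eps / 4 * p%:R)) * expect mu (fun w => expR (eps / 4 * (crossings m w)%:R)).
  rewrite -expectZ; apply: eq_bigr => w _; congr *%R.
  by rewrite -expRD; congr expR; ring.
have [e0 e2] := (eps_gt0, eps_le).
have h0 : 0 <= eps / 4 by lra.
apply: le_trans (ler_wpM2l (expR_ge0 _) (crossings_mgf m h0)) _.
rewrite -expRD ler_expR.
have : expR (eps / 4) <= 1 + eps / 4 + 2 * (eps / 4) ^+ 2.
  by apply: expR_le_quadratic; lra.
have e1 : 0 <= 1 - eps by lra.
have p0 : 0 <= p%:R :> R by [].
have ep : 0 <= (1 - eps) * p%:R by rewrite mulr_ge0.
rewrite -subr_ge0 => /(mulr_ge0 ep).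
have : 0 <= eps ^+ 3 * p%:R by rewrite mulr_ge0// exprn_ge0// ltW.
lra.
Qed.

Lemma prob_crossings_gt m :
  prob mu (fun w => p < crossings m w)%N <= expR (- (eps ^+ 2 * p%:R / 8)).
Proof.
apply: le_trans (crossings_excess_mgf m).
apply: (prob_le_expect mu_ge0) => w; first exact: expR_ge0.
move=> /ltnW pX; rewrite -[leLHS]expR0 ler_expR.
by rewrite mulr_ge0 ?subr_ge0 ?ler_nat// ltW// divr_gt0.
Qed.

(** The positive part of [z] is at most [(4 / eps) expR (eps z / 4)]. *)
Lemma expect_excess_le m :
  expect mu (fun w => (crossings m w - p)%:R) <=
  4 / eps * expR (- (eps ^+ 2 * p%:R / 8)).
Proof.
have h0 : 0 <= 4 / eps by rewrite divr_ge0// ltW.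
apply: le_trans (ler_wpM2l h0 (crossings_excess_mgf m)).
rewrite -expectZ; apply: (le_expect mu_ge0) => w.
have [le|/ltnW le] := leqP (crossings m w) p.
  by move: (le); rewrite -subn_eq0 => /eqP ->; rewrite mulr_ge0// expR_ge0.
rewrite natrB//; set z := _ - _.
have := ler_wpM2l h0 (expR_ge_lin (eps / 4 * z)).
suff -> : 4 / eps * (eps / 4 * z) = z by [].
by field; rewrite gt_eqF.
Qed.

Definition excess (W : {set M}) (w : {ffun K -> V}) : nat :=
  \sum_(m in W) D.+1 * (crossings m w - p).

Let g (W : {set M}) k : pred V := fun v => [exists m in W, xi k v m].

(** One draw accounts for at most [D] crossings, each worth at most [D + 1] units, and
    [D (D + 1) <= 4 D^2]. It has no effect when neither of its two values crosses during [W]. *)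
Lemma excess_lipschitz W :
  coord_lipschitz (4 * D%:R ^+ 2) (g W) (fun w => (excess W w)%:R : R).
Proof.
have half k w v u : (excess W (upd w k v) <=
    excess W (upd w k u) + D.+1 * \sum_(m in W) xi k v m)%N.
  rewrite big_distrr/= -big_split/=; apply: leq_sum => m _.
  rewrite -mulnDr leq_mul2l/=.
  suff : (crossings m (upd w k v) <= crossings m (upd w k u) + xi k v m)%N by lia.
  rewrite /crossings (bigD1 k)//= [in leqRHS](bigD1 k)//= !ffunE eqxx.
  rewrite (eq_bigr (fun l => xi l (upd w k u l) m : nat)); first by lia.
  by move=> l lk; rewrite !ffunE (negbTE lk).
have sumW k v : (\sum_(m in W) xi k v m <= D)%N.
  apply: leq_trans (xi_sum k v); rewrite [leqRHS](bigID (mem W))/=; lia.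
have sumW0 k v : ~~ g W k v -> (\sum_(m in W) xi k v m = 0)%N.
  move=> gv; rewrite big1// => m mW; apply/eqP; rewrite eqb0.
  by apply: contra gv => x; apply/existsP; exists m; rewrite mW.
move=> k w v u /=.
have := half k w v u; have := half k w u v.
move: (excess W _) (excess W _) (sumW k v) (sumW k u) (sumW0 k v) (sumW0 k u) => a b.
move: (\sum_(m in W) xi k v m)%N (\sum_(m in W) xi k u m)%N => s t sD tD s0 t0 hb ha.
have main : `|a%:R - b%:R| <= (D.+1 * maxn s t)%:R :> R.
  rewrite ler_norml lerBrDr lerBlDr addrC [(_)%:R + b%:R]addrC.
  rewrite lerBlDr -!natrD !ler_nat; apply/andP; split.
    apply: leq_trans hb _; rewrite leq_add2l leq_mul2l leq_max leqnn orbT orbT//.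
  by apply: leq_trans ha _; rewrite leq_add2l leq_mul2l leq_max leqnn orbT.
apply: le_trans main _.
case: (boolP (g W k v)) => gv; last case: (boolP (g W k u)) => gu.
- rewrite mulr1n -natrX -natrM ler_nat.
  have : (maxn s t <= D)%N by rewrite geq_max sD tD.
  nia.
- rewrite mulr1n -natrX -natrM ler_nat.
  have : (maxn s t <= D)%N by rewrite geq_max sD tD.
  nia.
- by rewrite s0// t0// maxnn muln0 mulr0n.
Qed.

(** A union bound over the steps of [W]: the probabilities that a draw crosses during [W] add up to
    at most the mean number of crossings in [W]. *)
Lemma excess_variance W :
  \sum_k \sum_v mu k v *+ g W k v <= #|W|%:R * p%:R.
Proof.
apply: (@le_trans _ _ (\sum_(m in W) \sum_k \sum_v mu k v *+ xi k v m)).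
  rewrite [leRHS]exchange_big/=; apply: ler_sum => k _.
  rewrite [leRHS]exchange_big/=; apply: ler_sum => v _.
  rewrite sumrMnr -[leLHS]mulr_natr -[leRHS]mulr_natr ler_wpM2l// ler_nat.
  case: (boolP (g W k v)) => // /existsP[m /andP[mW x]].
  by rewrite (bigD1 m)//= x.
rewrite -sum1_card natr_sum mulr_suml; apply: ler_sum => m _; rewrite mul1r.
apply: le_trans (xi_mean m) _; rewrite ler_piMl//.
by have := eps_gt0; lra.
Qed.

Hypothesis small :
  D.+1%:R * (4 / eps * expR (- (eps ^+ 2 * p%:R / 8))) <= 1 / 4.

(** By [small] the mean excess is at most [#|W| / 4], so reaching [#|W| / 2] is a deviation of at
    least [#|W| / 4]. *)
Lemma prob_excess (W : {set M}) :
  prob mu (fun w => #|W| <= 2 * excess W w)%N <=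
  expR (- (#|W|%:R / (4096 * D%:R ^+ 4 * p%:R))).
Proof.
pose f w : R := (excess W w)%:R.
pose t : R := #|W|%:R.
have Ef : expect mu f <= t / 4.
  have -> : f = fun w => \sum_(m in W) (D.+1 * (crossings m w - p))%:R.
    by apply/funext => w; rewrite /f /excess natr_sum.
  rewrite (expect_sum mu (index_enum M) (mem W)
    (fun m w => (D.+1 * (crossings m w - p))%:R)).
  rewrite /t -sum1_card natr_sum mulr_suml; apply: ler_sum => m _.
  have -> : (fun w => (D.+1 * (crossings m w - p))%:R) =
      fun w => D.+1%:R * (crossings m w - p)%:R :> R.
    by apply/funext => w; rewrite natrM.
  rewrite expectZ; apply: le_trans small.
  by rewrite ler_wpM2l// expect_excess_le.
have D0 : 0 < D%:R :> R by rewrite ltr0n.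
have D1 : 1 <= D%:R :> R by rewrite ler1n.
have p0 : 0 < p%:R :> R by rewrite ltr0n.
have p1 : 1 <= p%:R :> R by rewrite ler1n.
pose d : R := D%:R; pose q : R := p%:R.
(* With this value the variance term [64 lam^2 d^4 t q] equals [lam t / 8], half of the gain
   [lam t / 4]; what remains is [lam t / 8 = t / (4096 d^4 q)]. *)
pose lam : R := (512 * d ^+ 4 * q)^-1.
have den0 : 0 < 512 * d ^+ 4 * q by rewrite /d /q -natrX -!natrM ltr0n 2!muln_gt0 expn_gt0 D_gt0 p_gt0.
have lam0 : 0 < lam by rewrite invr_gt0.
have c0 : 0 <= 4 * d ^+ 2 by rewrite mulr_ge0// sqr_ge0.
have lc : lam * (4 * d ^+ 2) <= 1 / 2.
  rewrite mulrC ler_pdivrMr// -/d.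
  have : 0 <= d ^+ 4 * q - d ^+ 2.
    have -> : d ^+ 4 * q - d ^+ 2 = d ^+ 2 * (d ^+ 2 * (q - 1) + (d ^+ 2 - 1)) by ring.
    rewrite mulr_ge0 ?sqr_ge0// addr_ge0// ?mulr_ge0 ?sqr_ge0 ?subr_ge0//.
    by rewrite expr_ge1// ltW.
  have : 0 <= d ^+ 2 by exact: sqr_ge0.
  lra.
have := expect_expR_le mu_ge0 mu_sum1 (excess_lipschitz W)
  (fun k => lexx (\sum_v mu k v *+ g W k v)) c0 (ltW lam0) lc.
rewrite -/f -/d => H.
have {}H : expect mu (fun w => expR (lam * f w)) <=
    expR (lam * (t / 4) + 4 * lam ^+ 2 * (4 * d ^+ 2) ^+ 2 * (t * q)).
  apply: le_trans H _; rewrite ler_expR lerD//.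
    by rewrite ler_wpM2l// ltW.
  have l2 : 0 <= 4 * lam ^+ 2 * (4 * d ^+ 2) ^+ 2.
    by apply: mulr_ge0; [apply: mulr_ge0 => //|]; exact: sqr_ge0.
  exact: (ler_wpM2l l2 (excess_variance W)).
have : prob mu (fun w => #|W| <= 2 * excess W w)%N <=
    expect mu (fun w => expR (- (lam * (t / 2))) * expR (lam * f w)).
  apply: (prob_le_expect mu_ge0) => w; first by rewrite mulr_ge0// expR_ge0.
  move=> tf; rewrite -expRD -[leLHS]expR0 ler_expR addrC -mulrBr.
  rewrite mulr_ge0 ?(ltW lam0)// subr_ge0 ler_pdivrMr// mulrC.
  by rewrite /t /f -natrM ler_nat.
rewrite expectZ => /le_trans; apply.
apply: le_trans (ler_wpM2l (expR_ge0 _) H) _.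
rewrite -expRD ler_expR -/t -/d -/q.
rewrite le_eqVlt; apply/orP; left; apply/eqP.
rewrite /lam; field.
by rewrite !gt_eqF.
Qed.

End CrossingCounts.

(** * Windows formed by the last steps of the game *)

Section LastSteps.
Context {R : realType} {K V : finType} (i : nat) (mu : K -> V -> R).
Hypothesis mu_ge0 : forall k v, 0 <= mu k v.
Hypothesis mu_sum1 : forall k, \sum_v mu k v = 1.
Variables (xi : K -> V -> pred 'I_i) (D p : nat) (eps : R).
Hypotheses (D_gt0 : (0 < D)%N) (p_gt0 : (0 < p)%N).
Hypotheses (eps_gt0 : 0 < eps) (eps_le : eps <= 1 / 2).
Hypothesis xi_sum : forall k v, (\sum_m xi k v m <= D)%N.
Hypothesis xi_mean : forall m,
  \sum_k \sum_v mu k v *+ xi k v m <= (1 - eps) * p%:R.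
Hypothesis small :
  D.+1%:R * (4 / eps * expR (- (eps ^+ 2 * p%:R / 8))) <= 1 / 4.

(** The ordinal [m] stands for step [m + 1]. *)
Definition last_steps t : {set 'I_i} := [set m : 'I_i | (i - t <= m)%N]%SET.

Lemma sum_last_steps t (F : nat -> nat) :
  (\sum_(m in last_steps t) F m = \sum_(i - t <= m < i) F m)%N.
Proof.
rewrite (big_nat_widenl (i - t) 0)// big_mkord.
by apply: eq_bigl => m; rewrite inE.
Qed.

Lemma card_last_steps t : (t <= i)%N -> #|last_steps t| = t.
Proof.
move=> ti; rewrite -sum1_card (sum_last_steps t (fun=> 1%N)) sum_nat_const_nat.
by rewrite muln1 subKn.
Qed.

(** The full window of length [i] is a separate condition, required whatever [L] is: it serves to
    absorb the initial water. *)
Definition few_excess L (w : {ffun K -> V}) : bool :=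
  (2 * excess xi D p (last_steps i) w < i)%N &&
  [forall t : 'I_i, (L <= t)%N ==> (2 * excess xi D p (last_steps t) w < t)%N].

Definition rate : R := 4096 * D%:R ^+ 4 * p%:R.

Lemma rate_gt0 : 0 < rate.
Proof. by rewrite /rate -natrX -!natrM ltr0n 2!muln_gt0 expn_gt0 D_gt0 p_gt0. Qed.

Let prob_excess_last t : (t <= i)%N ->
  prob mu (fun w => t <= 2 * excess xi D p (last_steps t) w)%N <= expR (- (t%:R / rate)).
Proof.
move=> ti.
have := prob_excess mu_ge0 mu_sum1 D_gt0 p_gt0 eps_gt0 eps_le xi_sum xi_mean small (last_steps t).
by rewrite card_last_steps.
Qed.

(** A geometric series of ratio [rho = expR (- 1 / rate)], where [expR (1 / rate) >= 1 + 1 / rate]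
    gives [1 - rho >= 1 / (rate + 1)]. *)
Lemma sum_expR_le L m :
  \sum_(L <= t < m) expR (- (t%:R / rate)) <= (rate + 1) * expR (- (L%:R / rate)).
Proof.
have q0 := rate_gt0.
pose rho := expR (- rate^-1).
have rhoE t : expR (- (t%:R / rate)) = rho ^+ t.
  by rewrite /rho -expRM_natl mulrN.
have rho0 : 0 <= rho by exact: expR_ge0.
have h : (rate + 1)^-1 <= 1 - rho.
  have : rho <= (1 + rate^-1)^-1.
    by rewrite /rho expRN lef_pV2 ?posrE ?expR_gt0 ?addr_gt0 ?invr_gt0// expR_ge1Dx.
  have -> : (1 + rate^-1)^-1 = 1 - (rate + 1)^-1.
    by field; rewrite !gt_eqF// addr_gt0.
  lra.
have h0 : 0 < (rate + 1)^-1 by rewrite invr_gt0 addr_gt0.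
under eq_bigr do rewrite rhoE.
rewrite rhoE; apply: le_trans (geometric_tail_le _ _ _) _.
  by rewrite rho0 -subr_gt0 (lt_le_trans h0 h).
rewrite [leRHS]mulrC ler_wpM2l ?exprn_ge0//.
by rewrite invf_ple ?posrE ?(lt_le_trans h0 h)// addr_gt0.
Qed.

(** A union bound over the lengths from [L] to [i - 1], summed as a geometric series, and over the
    full window. *)
Lemma prob_not_few_excess L :
  prob mu (fun w => ~~ few_excess L w) <=
  (rate + 1) * expR (- (L%:R / rate)) + expR (- (i%:R / rate)).
Proof.
pose bad t w := (t <= 2 * excess xi D p (last_steps t) w)%N.
apply: (@le_trans _ _ (expect mu (fun w =>
    (\sum_(t < i | (L <= t)%N) (bad t w)%:R) + (bad i w)%:R))).
  apply: (le_expect mu_ge0) => w; rewrite /few_excess negb_and -leqNgt.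
  rewrite -/(bad i w); case: (boolP (bad i w)) => /= bi.
    by rewrite lerDr; apply: sumr_ge0 => t _; rewrite ler0n.
  rewrite addr0; case: (boolP [forall t, _]) => /= [_|].
    by apply: sumr_ge0 => t _; rewrite ler0n.
  rewrite negb_forall => /existsP[t]; rewrite negb_imply -leqNgt => /andP[Lt bt].
  rewrite (bigD1 t)//= /bad bt lerDl; apply: sumr_ge0 => u _; exact: ler0n.
rewrite expectD lerD//; last exact: prob_excess_last.
rewrite (expect_sum mu (index_enum 'I_i) (fun t : 'I_i => (L <= t)%N) (fun (t : 'I_i) w => (bad t w)%:R)).
apply: (@le_trans _ _ (\sum_(t < i | (L <= t)%N) expR (- (t%:R / rate)))).
  by apply: ler_sum => t _; apply: prob_excess_last; exact: ltnW.
have [iL|/ltnW Li] := leqP i L.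
  rewrite big1 ?mulr_ge0 ?expR_ge0 ?addr_ge0 ?ltW ?rate_gt0//.
  by move=> t /leq_trans; move=> /(_ _) h; have := ltn_ord t; rewrite ltnNge (leq_trans iL)// h.
apply: le_trans (sum_expR_le L i).
by rewrite (big_nat_widenl L 0)// big_mkord.
Qed.

Definition few_crossings L (w : {ffun K -> V}) : bool :=
  [forall m in last_steps L, (crossings xi m w <= p)%N].

Lemma prob_not_few_crossings L :
  prob mu (fun w => ~~ few_crossings L w) <= L%:R * expR (- (eps ^+ 2 * p%:R / 8)).
Proof.
apply: (@le_trans _ _ (expect mu (fun w =>
    \sum_(m in last_steps L) (p < crossings xi m w)%N%:R))).
  apply: (le_expect mu_ge0) => w; case: (boolP (few_crossings L w)) => /= [_|].
    by apply: sumr_ge0 => t _; rewrite ler0n.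
  rewrite negb_forall => /existsP[m]; rewrite negb_imply -ltnNge => /andP[mL pm].
  by rewrite (bigD1 m)//= pm lerDl; apply: sumr_ge0 => u _; exact: ler0n.
rewrite (expect_sum mu (index_enum 'I_i) (mem (last_steps L)) (fun m w => (p < crossings xi m w)%N%:R)).
apply: (@le_trans _ _ (\sum_(m in last_steps L) expR (- (eps ^+ 2 * p%:R / 8)))).
  by apply: ler_sum => m _; exact: (prob_crossings_gt mu_ge0 mu_sum1 eps_gt0 eps_le xi_mean).
rewrite sumr_const -[leLHS]mulr_natl ler_wpM2r ?expR_ge0// ler_nat.
have [Li|iL] := leqP L i; first by rewrite card_last_steps.
by apply: leq_trans (max_card _) _; rewrite card_ord ltnW.
Qed.

End LastSteps.

(** * Thresholds *)

(* The thresholds of a cup are indexed by the integers [g >= 1] with [g - 1] not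
   a multiple of [D + 1]: the threshold of index [g = i + t] lies in
   [(g, g + 1]]. *)
Definition threshold_index (D g : nat) : bool :=
  (0 < g)%N && (g.-1 %% D.+1 != 0)%N.

(** For [g = i + t] the remainder [g.-1 %% D.+1] is [t], so [sj] is taken at the block start [i]. *)
Definition threshold {R : realType} (D : nat) (sj : nat -> R) (g : nat) : R :=
  g%:R + sj (g - g.-1 %% D.+1)%N.

Definition count_thresholds {R : realType} (D : nat) (sj : nat -> R) (G : nat)
    (Q : R -> bool) : nat :=
  \sum_(g < G) (threshold_index D g && Q (threshold D sj g)).

Definition count_indices (D A : nat) : nat := \sum_(g < A) threshold_index D g.

(** Of the [A + 1] positive indices below [A + 2], exactly [A %/ D.+1 + 1] are block starts, which
    carry no threshold. *)
Lemma count_indicesE D A : (count_indices D A.+2 + A %/ D.+1 = A)%N.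
Proof.
elim: A => [|A IH]; first by rewrite div0n addn0 /count_indices !big_ord_recr big_ord0 /threshold_index.
have -> : count_indices D A.+3 = (count_indices D A.+2 + threshold_index D A.+2)%N.
  by rewrite /count_indices big_ord_recr.
rewrite divnS//.
have -> : threshold_index D A.+2 = ~~ (D.+1 %| A.+1)%N by [].
move: IH; case: (_ %| _)%N; lia.
Qed.

(** Thresholds have density [D / (D + 1) = 1 / (1 + delta)]; this bound and the next one control the
    rounding. *)
Lemma count_indices_le D A : (D.+1 * count_indices D A.+1 <= D * A)%N.
Proof.
case: A => [|A]; first by rewrite /count_indices big_ord_recr big_ord0 !muln0.
have := count_indicesE D A; have := divn_eq A D.+1; have := ltn_pmod A (ltn0Sn D).
by move: (count_indices _ _) (A %/ _)%N (A %% _)%N => h q r; nia.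
Qed.

Lemma count_indices_ge D A : (D * A <= D.+1 * count_indices D A.+2)%N.
Proof.
have := count_indicesE D A; have := divn_eq A D.+1; have := ltn_pmod A (ltn0Sn D).
by move: (count_indices _ _) (A %/ _)%N (A %% _)%N => h q r; nia.
Qed.

(** Regrouping by blocks, block [b] starting at [1 + b (D + 1)]. It serves both for counts in [nat]
    and for sums of reals. *)
Lemma big_threshold_index (S : Type) (idx : S) (op : Monoid.law idx) D B (F : nat -> S) :
  \big[op/idx]_(0 <= g < (B * D.+1).+1 | threshold_index D g) F g =
  \big[op/idx]_(b < B) \big[op/idx]_(t < D) F (1 + b * D.+1 + t.+1)%N.
Proof.
elim: B => [|B IH].
  by rewrite mul0n big_mkcond big_nat1 big_ord0.
rewrite [RHS]big_ord_recr/= -IH mulSn addnC -addSn.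
rewrite (big_cat_nat (n := (B * D.+1).+1))//= ?leq_addr//; congr (op _ _).
have := big_addn 0 ((B * D.+1).+1 + D.+1)%N (B * D.+1).+1 (threshold_index D) F.
rewrite add0n addKn => ->; rewrite big_mkcond big_nat_recl//.
rewrite add0n {1}/threshold_index/= modnMl/= Monoid.mul1m big_mkord.
apply: eq_bigr => t _; rewrite /threshold_index.
have -> : (t.+1 + (B * D.+1).+1 = (B * D.+1 + t.+1).+1)%N by lia.
by rewrite /= modnMDl modn_small// ltnS ltn_ord.
Qed.

Section Thresholds.
Context {R : realType} (D : nat) (sj : nat -> R).
Hypothesis sj_bound : forall i, block_start D i -> 0 < sj i <= 1.

Lemma block_start_index g : (0 < g)%N -> block_start D (g - g.-1 %% D.+1)%N.
Proof.
case: g => // g _ /=; have le := leq_mod g D.+1.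
split; first by rewrite subSn.
by rewrite subSn// -addn1 -modnDml {1}(divn_eq g D.+1) addnK modnMl.
Qed.

Lemma threshold_bound g : (0 < g)%N -> g%:R < threshold D sj g <= g.+1%:R.
Proof.
move=> g0; have /andP[h1 h2] := sj_bound (block_start_index g0).
by rewrite /threshold ltrDl h1 -[g.+1]addn1 natrD lerD2l.
Qed.

(** Indices at distance at least 2 are separated by the intervals [(g, g + 1]]. Consecutive indices
    lie in the same block, because a block start is not a threshold index, hence share their draw
    and differ by exactly 1. *)
Lemma thresholds_apart g g' : threshold_index D g -> threshold_index D g' ->
  (g < g')%N -> threshold D sj g + 1 <= threshold D sj g'.
Proof.
move=> gg gg' lt.
have g0 : (0 < g)%N by case/andP: gg.
have /andP[_ h1] := threshold_bound g0.
have [lt2|ge2] := ltnP g.+1 g'.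
  have g'0 : (0 < g')%N by exact: leq_ltn_trans lt.
  have /andP[h2 _] := threshold_bound g'0.
  have h3 : g.+1%:R + 1 <= g'%:R :> R by rewrite natr1 ler_nat.
  lra.
have {lt ge2} eg : g' = g.+1 by apply/eqP; rewrite eqn_leq ge2 lt.
rewrite {}eg in gg' *; rewrite /threshold /=.
suff -> : (g.+1 - g %% D.+1 = g - g.-1 %% D.+1)%N by rewrite -natr1; lra.
case: g gg gg' {g0 h1} => // g /andP[_ /= h1] /andP[_ /= h2].
suff -> : (g.+1 %% D.+1 = (g %% D.+1).+1)%N by rewrite subSS.
rewrite modnS; case: ifP => // h.
by move: h2; rewrite modnS h.
Qed.

Lemma threshold_inj : {in threshold_index D &, injective (threshold D sj)}.
Proof.
move=> g g' gg gg' e; case: (ltngtP g g') => // lt.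
  by have := thresholds_apart gg gg' lt; rewrite e gerDl ler10.
by have := thresholds_apart gg' gg lt; rewrite e gerDl ler10.
Qed.

(** The threshold of index [g] exceeds [g], so those that are at most [G] have index below [G];
    [threshold_inj] excludes double counting. *)
Lemma card_thresholds G (Q : R -> bool) : (forall x, Q x -> x <= G%:R) ->
  #|` fset_set (thresholds D sj `&` [set x | Q x])| = count_thresholds D sj G Q.
Proof.
move=> QG.
pose r := [seq threshold D sj g | g <- iota 0 G & threshold_index D g && Q (threshold D sj g)].
have -> : thresholds D sj `&` [set x | Q x] = [set` [fset x in r]%fset].
  apply/seteqP; split => x /=.
    move=> [[i [t [bi /andP[t1 tD] xE]]] Qx]; rewrite !inE; apply/mapP.
    have [i0 im] := bi.
    have im1 : (i.-1 %% D.+1 = 0)%N.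
      have : (i == 1 %[mod D.+1])%N by rewrite im.
      by rewrite eqn_mod_dvd// subn1 => /eqP.
    have gm : ((i + t).-1 %% D.+1 = t)%N.
      rewrite -(prednK i0) addSn /= -modnDml im1 add0n modn_small//.
    have xE' : x = threshold D sj (i + t) by rewrite /threshold gm addnK.
    exists (i + t)%N => //; rewrite mem_filter -xE' Qx andbT mem_iota add0n leq0n.
    have it0 : (0 < i + t)%N by rewrite addn_gt0 i0.
    rewrite /threshold_index it0 gm -lt0n t1/=.
    have /andP[h _] := threshold_bound it0.
    by rewrite -(ltr_nat R); apply: lt_le_trans h _; rewrite -xE'; exact: QG.
  rewrite !inE => /mapP[g]; rewrite mem_filter => /andP[/andP[gg Qg] _] xE.
  split; last by rewrite xE.
  have /andP[g0 gm] := gg.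
  exists (g - g.-1 %% D.+1)%N, (g.-1 %% D.+1)%N; split.
  - exact: block_start_index.
  - by rewrite lt0n gm -ltnS ltn_pmod.
  - by rewrite xE /threshold subnK// (leq_trans (leq_mod _ _))// leq_pred.
rewrite set_fsetK card_fseq undup_id; last first.
  rewrite map_inj_in_uniq ?filter_uniq ?iota_uniq// => g g'.
  rewrite !mem_filter => /andP[/andP[gg _] _] /andP[/andP[gg' _] _].
  exact: threshold_inj.
rewrite size_map size_filter -sumn_count sumnE big_map /count_thresholds.
by rewrite -(big_mkord xpredT (fun g => nat_of_bool (threshold_index D g && Q (threshold D sj g)))) /index_iota subn0.
Qed.

Lemma count_thresholds_le1 G (a a' : R) : a' <= a + 1 ->
  (count_thresholds D sj G (fun x => (a < x <= a')%R) <= 1)%N.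
Proof.
move=> aa'; rewrite /count_thresholds.
rewrite (eq_bigr (fun g : 'I_G => if (threshold_index D g && (a < threshold D sj g <= a')) then 1%N else 0%N)); last first.
  by move=> g _; case: (_ && _).
rewrite -big_mkcond sum1_card leqNgt; apply/negP => /card_gt1P[g [g' [hg hg' ne]]].
wlog lt : g g' hg hg' {ne} / (g < g')%N => [W|].
  by case: (ltngtP g g') => [/W|/W|/val_inj/eqP]; [exact|exact|exact/negP].
move: hg hg'; rewrite !unfold_in => /andP[hg /andP[h1 h2]] /andP[hg' /andP[h1' h2']].
have := thresholds_apart hg hg' lt; lra.
Qed.

Lemma count_thresholdsD G (a a' : R) : a <= a' ->
  (count_thresholds D sj G (fun x => x <= a')%R =
   count_thresholds D sj G (fun x => x <= a)%R
   + count_thresholds D sj G (fun x => (a < x <= a')%R))%N.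
Proof.
move=> aa'; rewrite /count_thresholds -big_split /=; apply: eq_bigr => g _.
case: (threshold_index _ _) => //=; case: (leP (threshold D sj g) a) => h /=.
  by rewrite (le_trans h aa').
by rewrite add0n.
Qed.

(** Let [A] be the integer part of [a]. All thresholds of index below [A] and none of index above
    [A] are counted, so the weighted count lies between [A - 2] and [A], while [A <= a < A + 1]. *)
Lemma count_thresholds_bound G (a delta : R) : 0 <= a -> a <= G%:R ->
  delta * D%:R = 1 -> 0 < delta ->
  0 <= a - (1 + delta) * (count_thresholds D sj G (fun x => x <= a))%:R <= 3.
Proof.
move=> a0 aG dD d0.
set N := count_thresholds _ _ _ _; pose A := Num.truncn a.
have /andP[A1 A2] : A%:R <= a < A.+1%:R by exact: truncn_itv.
have AG : (A <= G)%N by rewrite -(ler_nat R); exact: le_trans aG.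
have N_le : (N <= count_indices D A.+1)%N.
  rewrite /N /count_thresholds /count_indices.
  pose F g := nat_of_bool (threshold_index D g && (threshold D sj g <= a)).
  have F0 g : (A < g)%N -> F g = 0%N.
    move=> Ag; rewrite /F; case: (boolP (threshold_index D g)) => //= /andP[g0 _].
    have /andP[h _] := threshold_bound g0.
    rewrite leNgt (lt_trans _ h)//; apply: lt_le_trans A2 _.
    by rewrite ler_nat.
  rewrite -(big_mkord xpredT F) -(big_mkord xpredT (fun g => nat_of_bool (threshold_index D g))).
  have le1 : (\sum_(0 <= g < A.+1) F g <= \sum_(0 <= g < A.+1) threshold_index D g)%N.
    by apply: leq_sum => g _; rewrite /F; case: (threshold_index D g) => //=; case: (_ <= _).
  apply: leq_trans le1.
  case: (leqP A.+1 G) => h.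
    rewrite (big_cat_nat (n := A.+1))//= [X in (_ + X)%N]big_nat_cond [X in (_ + X)%N]big1 ?addn0//.
    by move=> g /andP[/andP[h1 _] _]; exact: F0.
  by rewrite (big_cat_nat (n := G) (p := A.+1))//= ?leq_addr// ltnW.
have N_ge : (count_indices D A <= N)%N.
  rewrite /N /count_thresholds /count_indices.
  pose F g := nat_of_bool (threshold_index D g && (threshold D sj g <= a)).
  rewrite -(big_mkord xpredT F) -(big_mkord xpredT (fun g => nat_of_bool (threshold_index D g))).
  rewrite (big_cat_nat (n := A) (p := G))//= -[leqLHS]addn0 leq_add//.
  rewrite !big_mkord; apply: leq_sum => -[g gA] _ /=; rewrite /F.
  case: (boolP (threshold_index D g)) => //= /andP[g0 _].
  have /andP[_ h] := threshold_bound g0.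
  rewrite (le_trans h)//; apply: le_trans A1; by rewrite ler_nat.
have Dd (x : nat) : (1 + delta) * x%:R = delta * (D.+1 * x)%:R.
  by rewrite natrM -natr1 mulrA mulrDr dD mulr1.
have Dd' (x : nat) : x%:R = delta * (D * x)%:R by rewrite natrM mulrA dD mul1r.
apply/andP; split.
  rewrite subr_ge0; apply: le_trans A1; rewrite Dd [leRHS]Dd' ler_pM2l// ler_nat.
  apply: leq_trans (count_indices_le D A).
  by rewrite leq_mul2l N_le orbT.
have [A_lt|A_ge] := ltnP A 2.
  have : A.+1%:R <= 2 :> R by rewrite (ler_nat _ _ 2).
  have : 0 <= (1 + delta) * N%:R by rewrite mulr_ge0// addr_ge0// ltW.
  lra.
have : (A - 2)%:R <= (1 + delta) * N%:R.
  rewrite Dd [leLHS]Dd' ler_pM2l// ler_nat.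
  have := count_indices_ge D (A - 2).
  rewrite (_ : (A - 2).+2 = A); last by lia.
  by move=> /leq_trans; apply; rewrite leq_mul2l N_ge orbT.
by rewrite natrB//; move: A2; rewrite -natr1; lra.
Qed.

Lemma threshold_block b t : (t < D)%N ->
  threshold D sj (1 + b * D.+1 + t.+1) =
  (1 + b * D.+1 + t.+1)%N%:R + sj (1 + b * D.+1)%N.
Proof.
move=> tD; rewrite /threshold.
have -> : (1 + b * D.+1 + t.+1).-1 = (b * D.+1 + t.+1)%N by [].
by rewrite modnMDl modn_small// addnK.
Qed.

(** The last index of block [B - 1] is [B (D + 1)], whence the cut-off. Each inner sum depends on a
    single draw. *)
Lemma count_thresholds_blocks B (Q : R -> bool) :
  count_thresholds D sj (B * D.+1).+1 Q =
  (\sum_(b < B) \sum_(t < D)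
     Q ((1 + b * D.+1 + t.+1)%N%:R + sj (1 + b * D.+1)%N)%R)%N.
Proof.
rewrite /count_thresholds.
rewrite -(big_mkord xpredT (fun g => nat_of_bool (threshold_index D g && Q (threshold D sj g)))).
rewrite (eq_bigr (fun g => if threshold_index D g then nat_of_bool (Q (threshold D sj g)) else 0%N)); last first.
  by move=> g _; case: (threshold_index D g).
rewrite -big_mkcond big_threshold_index; apply: eq_bigr => b _; apply: eq_bigr => t _.
by rewrite threshold_block.
Qed.

End Thresholds.

(** * The queue and the potential *)

(** [priority] for a counter of [v] units of [delta]: the level [1 + delta] is [D + 1] units. *)
Definition nat_priority (D v : nat) : nat :=
  (if D < v then 2 else (v != 0))%N.

(* Counters in units of [delta]: a crossing adds [D + 1], a selected cup loses up
   to [D + 2]. *)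
Lemma queue_step n p D (u x : 'I_n -> nat) (S : {set 'I_n}) :
  let u' j := (u j + D.+1 * x j)%N in
  let t j := if j \in S then minn D.+2 (u' j) else 0%N in
  (forall j, x j <= 1)%N -> #|S| = minn p.+1 n ->
  (forall j k, j \in S -> k \notin S ->
     nat_priority D (u' k) <= nat_priority D (u' j))%N ->
  (\sum_j (u' j - t j) <= (\sum_j u j).-1 + D.+1 * (\sum_j x j - p))%N.
Proof.
move=> u' t x1 cS prio.
(* The cups of top priority; every cup that crosses a threshold is among them. *)
pose H := [set j | (D < u' j)%N]%SET.
have HE j : (j \in H) = (D < u' j)%N by rewrite /H inE.
have tu j : (t j <= u' j)%N by rewrite /t; case: ifP => // _; exact: geq_minr.
have sumE : (\sum_j (u' j - t j) + \sum_j t j = \sum_j u j + D.+1 * \sum_j x j)%N.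
  rewrite big_distrr -!big_split/=; apply: eq_bigr => j _.
  by rewrite subnK.
have XH : (\sum_j x j <= #|H|)%N.
  rewrite -sum1_card [leqRHS]big_mkcond/=; apply: leq_sum => j _.
  rewrite HE /u'; case: (x j) (x1 j) => [|[|]]//= _; rewrite muln1.
  by rewrite addnS ltnS leq_addl.
have tH j : j \in S -> j \in H -> (D.+1 <= t j)%N.
  by rewrite /t HE => -> h; rewrite leq_min leqnSn.
(* If more than [p] cups have top priority, all [p + 1] selected ones do, and at least
   [(D + 1) (p + 1)] units leave. Otherwise all cups of [H] are selected and at most [p] thresholds
   are crossed. *)
have [pH|Hp] := ltnP p #|H|.
  have cS' : #|S| = p.+1.
    by rewrite cS; apply/minn_idPl; apply: leq_trans pH _; rewrite -[leqRHS]card_ord max_card.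
  have SH : S \subset H.
    apply/fintype.subsetP => j jS; apply/negPn/negP => jH.
    have [k kH kS] : exists2 k, k \in H & k \notin S.
      apply/fintype.subsetPn; apply/negP => HS.
      have HjS : H \proper S.
        by apply/fintype.properP; split => //; exists j.
      by have := proper_card HjS; rewrite cS' ltnNge; move: pH => ->.
    have := prio j k jS kS; move: kH jH; rewrite !HE /nat_priority => -> /negbTE ->.
    by case: (_ != _).
  have tS : (D.+1 * p.+1 <= \sum_j t j)%N.
    rewrite -cS' mulnC -sum_nat_const [leqRHS](bigID (mem S))/= -[leqLHS]addn0.
    by rewrite leq_add//; apply: leq_sum => j jS; rewrite tH// (fintype.subsetP SH).
  move: sumE tS; move: (\sum_j (u' j - t j))%N (\sum_j t j)%N (\sum_j u j)%N (\sum_j x j)%N.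
  move=> A B C X; have [pX|Xp] := leqP p X.
    have [k ->] : exists k, X = (p + k)%N by exists (X - p)%N; lia.
    by rewrite addKn; nia.
  by rewrite (_ : X - p = 0)%N; nia.
have HS : H \subset S.
  apply/fintype.subsetP => k kH; apply/negPn/negP => kS.
  have SH : S \subset H.
    apply/fintype.subsetP => j jS; have := prio j k jS kS.
    move: kH; rewrite !HE /nat_priority => ->; case: (D < u' j)%N => //.
    by case: (_ != _).
  have SHp : S \proper H by apply/fintype.properP; split => //; exists k.
  have := proper_card SHp; rewrite cS; case: (leqP p.+1 n) => [_|np].
    by move=> h; have := leq_trans h Hp; rewrite ltnNge leqnSn.
  by rewrite ltnNge -[X in (_ <= X)%N]card_ord max_card.
have Xp : (\sum_j x j <= p)%N := leq_trans XH Hp.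
move: (Xp); rewrite -subn_eq0 => /eqP ->; rewrite muln0 addn0.
have tHs : (D.+1 * #|H| <= \sum_(j in H) t j)%N.
  rewrite mulnC -sum_nat_const; apply: leq_sum => j jH.
  by rewrite tH// (fintype.subsetP HS).
have tHS : (\sum_j t j = \sum_(j in H) t j + \sum_(j | j \notin H) t j)%N.
  by rewrite (bigID (mem H)).
(* If more units leave than arrive, one unit is gained. Otherwise all inequalities are equalities:
   each cup of [H] loses exactly [D + 1] units and nothing else is removed. Since up to [D + 2]
   units can be removed, this forces every cup to be empty. *)
have [lt|ge] := ltnP (D.+1 * \sum_j x j) (\sum_j t j).
  move: sumE lt; move: (\sum_j (u' j - t j))%N (\sum_j t j)%N (\sum_j u j)%N (\sum_j x j)%N.
  by move=> A B C X; nia.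
have t0 : (\sum_(j | j \notin H) t j = 0)%N.
  by move: ge tHS tHs XH; move: (\sum_j x j)%N (\sum_j t j)%N (\sum_(j in H) t j)%N
    (\sum_(j | j \notin H) t j)%N => X A B C; nia.
have tE : (\sum_(j in H) t j = D.+1 * #|H|)%N.
  by move: ge tHS tHs XH; move: (\sum_j x j)%N (\sum_j t j)%N (\sum_(j in H) t j)%N
    (\sum_(j | j \notin H) t j)%N => X A B C; nia.
have tHE j : j \in H -> t j = D.+1.
  move=> jH; apply/eqP; rewrite eqn_leq (tH j (fintype.subsetP HS _ jH) jH) andbT.
  have : (D.+1 * #|(H :\ j)%SET| <= \sum_(i in (H :\ j)%SET) t i)%N.
    rewrite mulnC -sum_nat_const; apply: leq_sum => i; rewrite in_setD1 => /andP[_ iH].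
    by rewrite tH// (fintype.subsetP HS).
  move: tE; rewrite (big_setD1 j)//= (cardsD1 j) jH.
  by move: (\sum_(i in (H :\ j)%SET) t i)%N => A; rewrite mulnDr muln1 => e le; rewrite -(leq_add2r A) e leq_add2l.
suff -> : (\sum_j (u' j - t j) = 0)%N by [].
have noH j : j \in S -> j \notin H -> u' j = 0%N.
  move=> jS jH; have : t j = 0%N.
    by move/eqP: t0; rewrite sum_nat_eq0 => /forallP/(_ j); rewrite jH => /eqP.
  by rewrite /t jS => /eqP; rewrite -leqn0 geq_min /= leqn0 => /eqP.
apply/eqP; rewrite sum_nat_eq0; apply/forallP => j /=.
have [jS|jS] := boolP (j \in S).
  have [jH|jH] := boolP (j \in H); last by rewrite (noH j).
  have := tHE j jH; rewrite /t jS; case: leqP => // h; last by move=> ->; rewrite subnn.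
  by move/eqP; rewrite gtn_eqF.
(* For an unselected cup: [p + 1 > #|H|] cups are selected, so one of them lies outside [H] and is
   empty; by priority the unselected cup has counter 0 too. *)
have nS : (#|S| < n)%N.
  have : S \proper [set: 'I_n]%SET by apply/fintype.properP; split; [exact: finset.subsetT|exists j].
  by move/proper_card; rewrite cardsT card_ord.
have [k kS kH] : exists2 k, k \in S & k \notin H.
  apply/fintype.subsetPn; apply/negP => /subset_leq_card h.
  move: nS h; rewrite cS; case: (leqP p.+1 n) => [_ _ h|_]; last by rewrite ltnn.
  by have := leq_trans h Hp; rewrite ltnn.
have := prio k j kS jS; rewrite (noH k)// /nat_priority /=.
have jH : (D < u' j)%N = false.
  by apply/negbTE; apply: contra jS => h; apply: (fintype.subsetP HS); rewrite HE.
by rewrite jH; case: eqP => // ->.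
Qed.

(* [U] is the length of a queue in discrete time which serves one customer per
   step and receives [Z m] new ones at step [m]. *)
Lemma queue_empties (U Z : nat -> nat) (i L : nat) : (0 < i)%N ->
  (forall m, U m.+1 <= (U m).-1 + Z m.+1)%N ->
  (2 * U 0 <= i)%N -> (2 * \sum_(1 <= m < i.+1) Z m < i)%N ->
  (forall t, L <= t -> t < i ->
     2 * \sum_((i - t).+1 <= m < i.+1) Z m < t)%N ->
  exists tau, [/\ tau <= i, i - L <= tau & U tau = 0]%N.
Proof.
move=> i0 step U0 Zi Zt.
pose S t := (\sum_((i - t).+1 <= m < i.+1) Z m)%N.
have Srec t : (t < i)%N -> S t.+1 = (Z (i - t) + S t)%N.
  move=> ti; rewrite /S subnSK// big_ltn//; by rewrite ltnS leq_subr.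
(* Either the queue is empty at some time of the window, or one unit is served at each of its [t]
   steps. *)
have key t : (t <= i)%N -> (exists tau, [/\ tau <= i, i - t <= tau & U tau = 0]%N) \/
    (U i + t <= U (i - t)%N + S t)%N.
  elim: t => [|t IH] ti.
    by right; rewrite subn0 /S subn0 big_geq.
  case: (IH (ltnW ti)) => [[tau [h1 h2 h3]]|h].
    by left; exists tau; split => //; lia.
  have [U1|U1] := posnP (U (i - t.+1)%N).
    by left; exists (i - t.+1)%N; split => //; lia.
  right; rewrite Srec//.
  by have := step (i - t.+1)%N; rewrite subnSK//; lia.
(* A queue busy all along would serve [i] units, but the initial length is at most [i / 2] and the
   arrivals number less than [i / 2]. *)
have zero : exists tau, [/\ tau <= i & U tau = 0]%N.
  case: (key i (leqnn i)) => [[tau [h1 _ h3]]|]; first by exists tau.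
  by rewrite subnn /S subnn => h; exfalso; lia.
have ex : exists t, (t <= i)%N && (U (i - t)%N == 0%N).
  have [tau [h1 h2]] := zero.
  by exists (i - tau)%N; rewrite leq_subr subKn// h2.
(* The minimal [t] gives the last empty time [i - t]. If [t > L], the queue is busy afterwards,
   which requires at least [t] arrivals in the last [t] steps, more than allowed. *)
case: (ex_minnP ex) => t /andP[ti /eqP Ut] tmin.
exists (i - t)%N; split => //; first exact: leq_subr.
have [tL|Lt] := leqP t L; first by lia.
case: t ti Ut tmin Lt => // t ti Ut tmin Lt.
have U1 : (U (i - t)%N <= Z (i - t)%N)%N.
  by have := step (i - t.+1)%N; rewrite subnSK// Ut.
case: (key t (ltnW ti)) => [[tau [h1 h2 h3]]|h].
  have := tmin (i - tau)%N; rewrite leq_subr subKn// h3 eqxx => /(_ isT).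
  by lia.
have Ui : (0 < U i)%N.
  rewrite lt0n; apply/negP => /eqP e; have := tmin 0%N.
  by rewrite leq0n subn0 e eqxx => /(_ isT).
have St : (t < S t.+1)%N by rewrite Srec//; lia.
have [lt|ge] := ltnP t.+1 i.
  by have := Zt t.+1 (ltnW Lt) lt; rewrite -/(S t.+1); lia.
have e : t.+1 = i by apply/eqP; rewrite eqn_leq ti ge.
by move: Zi St; rewrite /S e subnn; lia.
Qed.

(** * The exponential potential of the fills *)

Section Potential.
Context {R : realType}.
Implicit Types a f c t eps theta : R.

(** The level 5 is the largest gap 3 between fill and counter plus [2 >= 1 + 2 delta]. Subtracting 1
    makes the potential vanish continuously there. *)
Definition potential a f : R := Num.max 0 (expR (a * (f - 5)) - 1).

Lemma potential_ge0 a f : 0 <= potential a f.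
Proof. by rewrite le_max lexx. Qed.

Lemma potential_le0 a f : 0 <= a -> f <= 5 -> potential a f <= 0.
Proof.
move=> a0 f5; rewrite ge_max lexx subr_le0 -[leRHS]expR0 ler_expR.
by rewrite mulr_ge0_le0// subr_le0.
Qed.

Lemma le_potential a f f' : 0 <= a -> f <= f' -> potential a f <= potential a f'.
Proof.
move=> a0 ff'; rewrite ge_max potential_ge0/= le_max; apply/orP; right.
by rewrite lerD2r ler_expR ler_wpM2l// lerD2r.
Qed.

(** Below the level [theta] the slope is at most [a expR (a (theta - 5))]. *)
Lemma potential_pour a f c theta : 0 <= a -> 0 <= c -> f + c <= theta ->
  potential a (f + c) <= potential a f + c * (a * expR (a * (theta - 5))).
Proof.
move=> a0 c0 fc; have e0 : 0 <= c * (a * expR (a * (theta - 5))).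
  by rewrite !mulr_ge0// expR_ge0.
rewrite ge_max addr_ge0 ?potential_ge0//=.
apply: (@le_trans _ _ (expR (a * (f - 5)) - 1 + c * (a * expR (a * (theta - 5))))).
  2: by rewrite lerD2r le_max lexx orbT.
rewrite [leRHS]addrAC lerD2r.
have -> : a * (f - 5) = a * (f + c - 5) + - (a * c) by ring.
rewrite expRD.
have h1 : 1 - a * c <= expR (- (a * c)) by have := expR_ge1Dx (- (a * c)); lra.
have h2 : expR (a * (f + c - 5)) <= expR (a * (theta - 5)).
  by rewrite ler_expR ler_wpM2l// lerD2r.
have := ler_wpM2l (expR_ge0 (a * (f + c - 5))) h1.
have := ler_wpM2l (mulr_ge0 a0 c0) h2; lra.
Qed.

(** The fill drops by at least [1 - c] and ends at [theta - 2] or above, where the slope is at least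
    [a expR (a (theta - 7))]; [theta >= 7] keeps it above 5. *)
Lemma potential_empty a f c t theta : 0 <= a -> c <= 1 -> 1 <= t -> t <= 2 ->
  7 <= theta -> theta <= f + c ->
  potential a (f + c - t) <=
  potential a f - (1 - c) * (a * (expR (a * (theta - 5)) * expR (- (2 * a)))).
Proof.
move=> a0 c1 t1 t2 th fc.
have x5 : 0 <= a * (f + c - t - 5) by rewrite mulr_ge0//; lra.
have -> : potential a (f + c - t) = expR (a * (f + c - t - 5)) - 1.
  by apply/max_idPr; rewrite subr_ge0 -[leLHS]expR0 ler_expR.
have h : expR (a * (f - 5)) - 1 <= potential a f by rewrite le_max lexx orbT.
apply: le_trans (lerB h (lexx _)).
rewrite [leRHS]addrAC lerD2r -expRD.
have -> : a * (f - 5) = a * (f + c - t - 5) + a * (t - c) by ring.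
have h1 : 1 + a * (1 - c) <= expR (a * (t - c)).
  apply: le_trans (expR_ge1Dx _) _; rewrite ler_expR ler_wpM2l//; lra.
have h2 : expR (a * (theta - 5) - 2 * a) <= expR (a * (f + c - t - 5)).
  rewrite ler_expR.
  have -> : a * (theta - 5) - 2 * a = a * (theta - 7) by ring.
  by rewrite ler_wpM2l//; lra.
rewrite (expRD (a * (f + c - t - 5))).
have := ler_wpM2l (expR_ge0 (a * (f + c - t - 5))) h1.
have ac : 0 <= a * (1 - c) by rewrite mulr_ge0// subr_ge0.
have := ler_wpM2l ac h2; lra.
Qed.

(** If all cups above 5 are selected, no term increases. Otherwise a level [theta] separates
    selected from unselected cups, and the losses of the former are compared with the gains of the
    latter. *)
Lemma potential_step n p (eps : R) (f c t : 'I_n -> R) (S : {set 'I_n}) :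
  0 <= eps -> eps <= 1 / 2 ->
  (forall j, 0 <= c j <= 1) -> \sum_j c j <= (1 - eps) * p%:R ->
  (forall j, j \notin S -> t j = 0) -> (forall j, 0 <= t j <= 2) ->
  (forall j, j \in S -> 5 < f j + c j -> 1 <= t j) ->
  (forall j, 5 < f j + c j -> j \in S) \/
  (#|S| = p.+1 /\ exists theta, [/\ 5 < theta,
     forall j, j \in S -> theta <= f j + c j &
     forall j, j \notin S -> f j + c j <= theta]) ->
  \sum_j potential (eps / 2) (f j + c j - t j) <=
  \sum_j potential (eps / 2) (f j) + p%:R.
Proof.
move=> e0 e2 c01 sc tS t02 t1; set a := eps / 2.
have a0 : 0 <= a by rewrite divr_ge0.
case=> [all5|[cS [theta [th5 thS thN]]]].
  apply: (@le_trans _ _ (\sum_j potential a (f j))); last by rewrite lerDl.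
  apply: ler_sum => j _; have /andP[c0 c1] := c01 j; have /andP[t0 _] := t02 j.
  have [le|lt] := leP (f j + c j) 5.
    by apply: le_trans (potential_ge0 _ _); apply: potential_le0 => //; lra.
  by apply: le_potential => //; have := t1 j (all5 j lt) lt; lra.
set e := expR (a * (theta - 5)).
have inS j : j \in S -> 1 <= t j by move=> jS; apply: t1 => //; apply: lt_le_trans (thS j jS).
have ep : 0 <= a * e by rewrite mulr_ge0// expR_ge0.
have splitc : \sum_j c j = \sum_(j in S) c j + \sum_(j | j \notin S) c j.
  by rewrite (bigID (mem S)).
have cS0 : 0 <= \sum_(j in S) c j by apply: sumr_ge0 => j _; case/andP: (c01 j).
have outC0 : 0 <= \sum_(j | j \notin S) c j by apply: sumr_ge0 => j _; case/andP: (c01 j).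
have outS : \sum_(j | j \notin S) potential a (f j + c j - t j) <=
    \sum_(j | j \notin S) potential a (f j) + (\sum_(j | j \notin S) c j) * (a * e).
  rewrite mulr_suml -big_split/=; apply: ler_sum => j jS.
  rewrite tS// subr0; apply: potential_pour => //; last exact: thN.
  by case/andP: (c01 j).
rewrite (bigID (mem S))/= [X in _ <= X + _](bigID (mem S))/=.
have p0 : 0 <= p%:R :> R by [].
(* With [v] and [w] poured outside and inside [S], the change divided by [a e] is at most
   [v - (1 - eps) (p + 1 - w)], which is negative because [v + w <= (1 - eps) p]. *)
have [th7|th7] := leP 7 theta.
  have : \sum_(j in S) potential a (f j + c j - t j) <=
      \sum_(j in S) potential a (f j) -
        (\sum_(j in S) (1 - c j)) * (a * (e * expR (- (2 * a)))).
    rewrite mulr_suml -sumrB; apply: ler_sum => j jS.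
    apply: potential_empty => //; [|exact: inS| |exact: thS].
      by case/andP: (c01 j).
    by case/andP: (t02 j).
  rewrite sumrB sumr_const cS -mulr_natl mulr1 -natr1.
  have k1 : 1 - eps <= expR (- (2 * a)).
    have -> : - (2 * a) = - eps by rewrite /a; field.
    by have := expR_ge1Dx (- eps); lra.
  move: splitc outS; move: (\sum_(j | j \notin S) c j) (\sum_(j in S) c j) cS0 outC0 => v w w0 v0 splitc outS.
  have wp : w <= p%:R.
    have : 0 <= eps * p%:R by rewrite mulr_ge0.
    lra.
  have h1 := ler_wpM2l ep k1.
  have h2 : 0 <= p%:R + 1 - w by lra.
  have := ler_wpM2r h2 h1.
  have : (v + w) * (a * e) <= (1 - eps) * p%:R * (a * e).
    by rewrite ler_wpM2r// addrC -splitc.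
  have : 0 <= a * e * (eps * w) by rewrite (mulr_ge0 ep)// mulr_ge0.
  have : 0 <= a * e * (1 - eps) by rewrite mulr_ge0//; lra.
  lra.
have : \sum_(j in S) potential a (f j + c j - t j) <= \sum_(j in S) potential a (f j).
  (* For [theta < 7], selected cups gain nothing and the slope elsewhere is at most [a e <= 1], so
     the gain is at most the water poured. *)
  apply: ler_sum => j jS; apply: le_potential => //.
  by have := inS j jS; case/andP: (c01 j); lra.
have e1 : a * e <= 1.
  have : e <= expR eps.
    rewrite ler_expR.
    have -> : eps = a * 2 by rewrite /a; field.
    by rewrite ler_wpM2l//; lra.
  have := expR_le_quadratic e2.
  have : eps * eps <= 1 / 2 * (1 / 2) by apply: ler_pM.
  move=> h1 h2 h3; have : e <= 2 by rewrite expr2 in h2; lra.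
  move=> h4; have := ler_wpM2l a0 h4; rewrite /a; lra.
have : (\sum_(j | j \notin S) c j) * (a * e) <= p%:R * 1.
  apply: ler_pM => //.
  have : 0 <= eps * p%:R by rewrite mulr_ge0.
  lra.
lra.
Qed.

End Potential.

(** * The game for fixed draws *)

Section Game.
Context {R : realType} (n p D : nat) (delta eps b : R).
Variables (sj : 'I_n -> nat -> R).
Variables (sel : nat -> ('I_n -> R) -> ('I_n -> R) -> {set 'I_n}).
Variables (a0 : 'I_n -> R) (c : nat -> 'I_n -> R).
Hypotheses (D_gt1 : (1 < D)%N) (dD : delta * D%:R = 1).
Hypotheses (eps_gt0 : 0 < eps) (eps_le : eps <= 1 / 2).
Hypothesis sj_bound : forall j i, block_start D i -> 0 < sj j i <= 1.
Hypothesis sel_greedy : greedy_rule p delta sel.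
Hypothesis a0_water : initial_water b a0.
Hypothesis c_filler : filler p eps c.

Let st m := state_after D delta sj a0 c sel m.

Lemma delta_gt0 : 0 < delta.
Proof.
have D0 : 0 < D%:R :> R by rewrite ltr0n ltnW.
by rewrite -(pmulr_lgt0 _ D0) dD.
Qed.

Lemma delta_le : delta <= 1 / 2.
Proof.
have d0 := delta_gt0.
have D2 : 2 <= D%:R :> R by rewrite (ler_nat _ 2).
by have := ler_wpM2l (ltW d0) D2; rewrite dD; lra.
Qed.

Lemma poured0 j : poured a0 c 0 j = a0 j.
Proof. by rewrite /poured big_geq// addr0. Qed.

Lemma pouredS m j : poured a0 c m.+1 j = poured a0 c m j + c m.+1 j.
Proof. by rewrite /poured big_nat_recr//= addrA. Qed.

Lemma pour_bound m j : 0 <= c m.+1 j <= 1.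
Proof. by case: (c_filler (ltn0Sn m)). Qed.

Lemma poured_bound m j : 0 <= poured a0 c m j <= b + m%:R.
Proof.
have [a0_ge0 a0_sum] := a0_water.
elim: m => [|m /andP[IH1 IH2]].
  rewrite poured0 a0_ge0 addr0 -a0_sum (bigD1 j)//= lerDl.
  by apply: sumr_ge0.
have /andP[c0 c1] := pour_bound m j.
by rewrite pouredS addr_ge0//= -natr1 addrA lerD.
Qed.

Lemma nb_thresholds_leE j G (a : R) : a <= G%:R ->
  nb_thresholds_le D (sj j) a = count_thresholds D (sj j) G (fun x => x <= a).
Proof.
move=> aG; rewrite /nb_thresholds_le (@card_thresholds R D (sj j) (@sj_bound j) G (fun x => x <= a))//.
by move=> x xa; exact: le_trans xa aG.
Qed.

Lemma nb_crossedE j G (a a' : R) : a' <= G%:R ->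
  nb_crossed D (sj j) a a' = count_thresholds D (sj j) G (fun x => a < x <= a').
Proof.
move=> aG; rewrite /nb_crossed (@card_thresholds R D (sj j) (@sj_bound j) G (fun x => a < x <= a'))//.
by move=> x /andP[_ xa]; exact: le_trans xa aG.
Qed.

Definition crossed m j : nat := nb_crossed D (sj j) (poured a0 c m.-1 j) (poured a0 c m j).

Lemma nat_ubound (x : R) : exists G : nat, x <= G%:R.
Proof.
exists (Num.truncn `|x|).+1; apply: le_trans (ler_norm x) _; apply/ltW.
by case/andP: (truncn_itv (normr_ge0 x)).
Qed.

Lemma nb_thresholds_leS m j :
  (nb_thresholds_le D (sj j) (poured a0 c m.+1 j) =
   nb_thresholds_le D (sj j) (poured a0 c m j) + crossed m.+1 j)%N.
Proof.
have [G aG] := nat_ubound (poured a0 c m.+1 j).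
have le : poured a0 c m j <= poured a0 c m.+1 j.
  by rewrite pouredS lerDl; case/andP: (pour_bound m j).
rewrite (@nb_thresholds_leE _ G _ aG) (@nb_thresholds_leE _ G _ (le_trans le aG)).
by rewrite /crossed (@nb_crossedE _ G _ _ aG) (count_thresholdsD _ _ _ le).
Qed.

Lemma crossed_le1 m j : (crossed m.+1 j <= 1)%N.
Proof.
have [G aG] := nat_ubound (poured a0 c m.+1 j).
rewrite /crossed (@nb_crossedE _ G _ _ aG); apply: (count_thresholds_le1 (@sj_bound j)).
by rewrite /= pouredS lerD2l; case/andP: (pour_bound m j).
Qed.

Lemma thresholds_gap m j :
  0 <= poured a0 c m j - (1 + delta) * (nb_thresholds_le D (sj j) (poured a0 c m j))%:R <= 3.
Proof.
have [G aG] := nat_ubound (poured a0 c m j).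
rewrite (@nb_thresholds_leE _ G _ aG); apply: (count_thresholds_bound (@sj_bound j)) => //.
  by case/andP: (poured_bound m j).
exact: delta_gt0.
Qed.

Definition fill_poured m j := fill (st m) j + c m.+1 j.

Definition counter_poured m j := counter (st m) j + (1 + delta) * (crossed m.+1 j)%:R.

Definition selected m := sel m.+1 (fill_poured m) (counter_poured m).

Definition removed m j : R :=
  if j \in selected m then Num.min (1 + 2 * delta) (counter_poured m j) else 0.

Lemma fillS m j : fill (st m.+1) j = fill_poured m j - removed m j.
Proof. by []. Qed.

Lemma counterS m j : counter (st m.+1) j = counter_poured m j - removed m j.
Proof. by []. Qed.

(** The emptier removes the same amount from the fill and from the counter, so the difference
    depends only on the pouring and on the thresholds. *)
Lemma fill_minus_counter m j : fill (st m) j - counter (st m) j =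
  poured a0 c m j - (1 + delta) * (nb_thresholds_le D (sj j) (poured a0 c m j))%:R.
Proof.
elim: m => [|m IH]; first by rewrite poured0.
rewrite fillS counterS nb_thresholds_leS pouredS natrD.
by rewrite /fill_poured /counter_poured; move: IH; lra.
Qed.

Lemma fill_counter m j : 0 <= fill (st m) j - counter (st m) j <= 3.
Proof. by rewrite fill_minus_counter thresholds_gap. Qed.

Lemma fill_counter_poured m j : 0 <= fill_poured m j - counter_poured m j <= 3.
Proof.
have -> : fill_poured m j - counter_poured m j =
  fill (st m.+1) j - counter (st m.+1) j by rewrite fillS counterS; ring.
exact: fill_counter.
Qed.

(** The counter in units of [delta]; the truncation is exact by [counterE]. *)
Definition ucounter m j : nat := Num.truncn (D%:R * counter (st m) j).

Lemma delta1E : 1 + delta = delta * D.+1%:R.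
Proof. by rewrite -natr1 mulrDr dD mulr1. Qed.

Lemma delta2E : 1 + 2 * delta = delta * D.+2%:R.
Proof. by rewrite -!natr1 !mulrDr dD !mulr1; ring. Qed.

Lemma counter_poured_nat m j k : counter (st m) j = delta * k%:R ->
  counter_poured m j = delta * (k + D.+1 * crossed m.+1 j)%:R.
Proof. by move=> E; rewrite /counter_poured E delta1E natrD natrM mulrDr mulrA. Qed.

Lemma removed_nat m j k : counter_poured m j = delta * k%:R ->
  removed m j = delta * (if j \in selected m then minn D.+2 k else 0%N)%:R.
Proof.
move=> E; rewrite /removed E; case: ifP => _; last by rewrite mulr0.
rewrite delta2E -minr_pMr ?ltW ?delta_gt0//; congr *%R.
by case: (leqP D.+2 k) => h; [apply/min_idPl|apply/min_idPr]; rewrite ler_nat// ltnW.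
Qed.

Lemma counterE m j : counter (st m) j = delta * (ucounter m j)%:R.
Proof.
suff [k E] : exists k : nat, counter (st m) j = delta * k%:R.
  by rewrite /ucounter E mulrA [D%:R * _]mulrC dD mul1r natrK.
elim: m => [|m [k IH]].
  exists (D.+1 * nb_thresholds_le D (sj j) (a0 j))%N.
  by rewrite natrM mulrA -delta1E.
have E := counter_poured_nat IH.
exists (k + D.+1 * crossed m.+1 j - (if j \in selected m then minn D.+2 (k + D.+1 * crossed m.+1 j) else 0))%N.
rewrite counterS (removed_nat E) E -mulrBr -natrB//.
by case: ifP => // _; exact: geq_minr.
Qed.

Lemma counter_ge0 m j : 0 <= counter (st m) j.
Proof. by rewrite counterE mulr_ge0// ltW// delta_gt0. Qed.

Lemma ucounterS m j : ucounter m.+1 j =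
  (ucounter m j + D.+1 * crossed m.+1 j -
   (if j \in selected m then minn D.+2 (ucounter m j + D.+1 * crossed m.+1 j) else 0))%N.
Proof.
apply/eqP; rewrite -(eqr_nat R) -(inj_eq (mulfI (lt0r_neq0 delta_gt0))) -counterE.
have E := counter_poured_nat (counterE m j).
rewrite counterS (removed_nat E) E -mulrBr natrB//.
by case: ifP => // _; exact: geq_minr.
Qed.

Lemma priorityE (v : nat) : priority delta (delta * v%:R) = nat_priority D v.
Proof.
rewrite /priority /nat_priority delta1E ler_pM2l ?delta_gt0// ler_nat.
by rewrite mulf_eq0 (gt_eqF delta_gt0)/= pnatr_eq0; case: (D < v)%N => //; case: (v == 0%N).
Qed.

Definition queue_length m : nat := \sum_j ucounter m j.

Lemma queue_lengthS m : (queue_length m.+1 <=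
  (queue_length m).-1 + D.+1 * (\sum_j crossed m.+1 j - p))%N.
Proof.
have [cS prio] := sel_greedy m.+1 (fill_poured m) (counter_poured m).
rewrite /queue_length; under eq_bigr do rewrite ucounterS.
apply: queue_step => //; first exact: crossed_le1.
move=> j k jS kS; have := prio j k jS kS.
rewrite !(counter_poured_nat (counterE m _)) !priorityE => -[/ltnW//|[-> _]].
exact: leqnn.
Qed.

(** Counters never exceed fills, so initially [delta] times the queue length is at most [b]. *)
Lemma queue_length0 i : 2 * b / delta <= i%:R -> (2 * queue_length 0 <= i)%N.
Proof.
have d0 := delta_gt0.
rewrite ler_pdivrMr// => bi; rewrite -(ler_nat R) -(ler_pM2r d0).
apply: le_trans bi; rewrite natrM -mulrA ler_wpM2l//.
have [_ <-] := a0_water; rewrite /queue_length natr_sum mulr_suml.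
apply: ler_sum => j _; rewrite mulrC -counterE -subr_ge0.
by case/andP: (fill_counter 0 j).
Qed.

Lemma fill_le3 m j : queue_length m = 0%N -> fill (st m) j <= 3.
Proof.
move/eqP; rewrite sum_nat_eq0 => /forallP/(_ j)/eqP u0.
by have /andP[_] := fill_counter m j; rewrite counterE u0 mulr0 subr0.
Qed.

Lemma backlog_le m (x : R) : 0 <= x -> (forall j, fill (st m) j <= x) -> backlog (st m) <= x.
Proof. by move=> x0 h; apply: bigmax_le. Qed.

Definition total_potential m : R := \sum_j potential (eps / 2) (fill (st m) j).

(** A cup filled above 5 has a counter above 2, hence top priority, and loses at least 1 when
    selected. *)
Lemma total_potentialS m : total_potential m.+1 <= total_potential m + p%:R.
Proof.
have [d0 d2] := (delta_gt0, delta_le).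
have [c01 csum] := c_filler (ltn0Sn m).
have [cS prio] := sel_greedy m.+1 (fill_poured m) (counter_poured m).
have w0 j : 0 <= counter_poured m j.
  by rewrite addr_ge0 ?counter_ge0// mulr_ge0// addr_ge0// ltW.
have big j : 5 < fill_poured m j -> 2 < counter_poured m j.
  by have := fill_counter_poured m j; lra.
apply: (@potential_step R n p eps (fill (st m)) (c m.+1) (removed m) (selected m)) => //.
- exact: ltW.
- by move=> j /negbTE jS; rewrite /removed jS.
- move=> j; rewrite /removed; case: ifP => _; last by rewrite lexx; lra.
  by rewrite le_min w0 ge_min andbT; apply/andP; split; [lra|apply/orP; left; lra].
- move=> j jS /big w2; rewrite /removed jS le_min; apply/andP; split; lra.
have [all5|] := boolP [forall j, (5 < fill_poured m j) ==> (j \in selected m)].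
  by left => j f5; move/forallP: all5 => /(_ j)/implyP; exact.
rewrite negb_forall => /existsP[k0]; rewrite negb_imply => /andP[k05 k0S].
right; split.
  rewrite cS; apply/minn_idPl.
  have : selected m \proper [set: 'I_n]%SET.
    by apply/fintype.properP; split; [exact: finset.subsetT|exists k0].
  move/proper_card; rewrite cardsT card_ord cS.
  by move=> h; lia.
(* The level [theta] is the fill of the fullest unselected cup. That cup has top priority, so the
   selected cups have it too and are at least as full. *)
case: (@arg_maxP _ _ _ k0 (fun k => k \notin selected m) (fill_poured m) k0S) => k kS kmax.
have k5 : 5 < fill_poured m k by apply: lt_le_trans k05 _; exact: kmax.
exists (fill_poured m k); split => // j jS.
have k2 : priority delta (counter_poured m k) = 2%N.
  by rewrite /priority ifT//; have := big k k5; lra.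
have [|[_]//] := prio j k jS kS.
rewrite k2 ltnNge /priority.
by case: ifP => // _; case: ifP.
Qed.

Lemma total_potential_ge0 m : 0 <= total_potential m.
Proof. by apply: sumr_ge0 => j _; exact: potential_ge0. Qed.

Lemma fill_le_total_potential m j :
  fill (st m) j <= 5 + 2 / eps * ln (1 + total_potential m).
Proof.
have e0 := eps_gt0.
have h : expR (eps / 2 * (fill (st m) j - 5)) <= 1 + total_potential m.
  rewrite -lerBlDl; apply: (@le_trans _ _ (potential (eps / 2) (fill (st m) j))).
    by rewrite le_max lexx orbT.
  rewrite /total_potential (bigD1 j)//= lerDl; apply: sumr_ge0 => k _.
  exact: potential_ge0.
have p0 : 0 < 1 + total_potential m by rewrite ltr_pwDl// total_potential_ge0.
have {}h : eps / 2 * (fill (st m) j - 5) <= ln (1 + total_potential m).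
  by rewrite -[leLHS]expRK ler_ln ?posrE ?expR_gt0.
have h2 : 0 <= 2 / eps by rewrite divr_ge0// ltW.
rewrite -lerBlDl; have := ler_wpM2l h2 h.
by have -> : 2 / eps * (eps / 2 * (fill (st m) j - 5)) = fill (st m) j - 5
  by field; rewrite gt_eqF.
Qed.

Definition arrivals m : nat := D.+1 * (\sum_j crossed m j - p).

Section AfterEmptying.
Variables (i L : nat).
Hypotheses (i_gt0 : (0 < i)%N) (b_le : 2 * b / delta <= i%:R).
Hypothesis few_total : (2 * \sum_(1 <= m < i.+1) arrivals m < i)%N.
Hypothesis few : forall t, (L <= t)%N -> (t < i)%N ->
  (2 * \sum_((i - t).+1 <= m < i.+1) arrivals m < t)%N.

Let empty_before :
  exists tau, [/\ tau <= i, i - L <= tau & queue_length tau = 0]%N.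
Proof.
by apply: (@queue_empties _ arrivals) => //; [exact: queue_lengthS|exact: queue_length0].
Qed.

Lemma backlog_le3 : (forall m, (i - L < m)%N -> (m <= i)%N -> (\sum_j crossed m j <= p)%N) ->
  backlog (st i) <= 3.
Proof.
move=> good; have [tau [ti Lt q0]] := empty_before.
apply: backlog_le => // j; apply: fill_le3.
(* Induction from the empty time [tau] on: without arrivals the queue stays empty. *)
rewrite -(subnKC ti); move: (subnKC ti) => e.
have : (i - tau <= i - tau)%N by [].
elim: {1 3}(i - tau)%N => [|d IH] dle; first by rewrite addn0.
have := queue_lengthS (tau + d); rewrite IH ?(ltnW dle)// add0n -addnS.
have : (\sum_j crossed (tau + d.+1) j <= p)%N by apply: good; lia.
by rewrite -subn_eq0 => /eqP ->; rewrite muln0 leqn0 => /eqP.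
Qed.

(** At the empty time all fills are at most 3 and the potential is 0; at most [L] steps follow, each
    adding at most [p]. *)
Lemma backlog_le_ln : backlog (st i) <= 5 + 2 / eps * ln (1 + (L * p)%:R).
Proof.
have [tau [ti Lt q0]] := empty_before.
have e0 : 0 <= 2 / eps by rewrite divr_ge0// ltW// eps_gt0.
have pot0 : total_potential tau <= 0.
  apply: sumr_le0 => j _; apply: potential_le0; first by rewrite divr_ge0// ltW// eps_gt0.
  by have := fill_le3 j q0; lra.
have pot d : total_potential (tau + d) <= (d * p)%:R.
  elim: d => [|d IH]; first by rewrite addn0.
  rewrite addnS; apply: le_trans (total_potentialS _) _.
  by rewrite mulSn natrD addrC lerD2l.
have potL : total_potential i <= (L * p)%:R.
  rewrite -(subnKC ti); apply: le_trans (pot _) _.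
  by rewrite ler_nat leq_mul2r; apply/orP; right; lia.
apply: backlog_le => [|j].
  by rewrite addr_ge0// mulr_ge0// ln_ge0// lerDl.
apply: le_trans (fill_le_total_potential i j) _; rewrite lerD2l ler_wpM2l//.
have h := total_potential_ge0 i.
by rewrite ler_ln ?posrE ?lerD2l// ltr_pwDl.
Qed.

End AfterEmptying.

End Game.

(** * The game with random draws *)

Section FiniteValued.
Context d (T : measurableType d) (R : realType) (P : probability T R).

Lemma measurable_in_seq (V : eqType) (Y : T -> V) (r : seq V) :
  (forall v, measurable [set x | Y x = v]) -> measurable [set x | Y x \in r].
Proof.
move=> mY; elim: r => [|v r IH].
  by rewrite (_ : [set x | _] = set0)//; apply/seteqP; split.
rewrite (_ : [set x | _] = [set x | Y x = v] `|` [set x | Y x \in r]).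
  exact: measurableU.
apply/seteqP; split => x /=; rewrite inE.
  by case/orP => [/eqP|]; [left|right].
by case=> [->|->]; rewrite ?eqxx ?orbT.
Qed.

Lemma probability_in_seq (V : eqType) (Y : T -> V) (r : seq V) :
  (forall v, measurable [set x | Y x = v]) -> uniq r ->
  P [set x | Y x \in r] = (\sum_(v <- r) P [set x | Y x = v])%E.
Proof.
move=> mY; elim: r => [|v r IH] /=.
  move=> _; rewrite big_nil (_ : [set x | _] = set0) ?measure0//.
  by apply/seteqP; split.
move=> /andP[vr ur]; rewrite big_cons -IH//.
rewrite (_ : [set x | _] = [set x | Y x = v] `|` [set x | Y x \in r]).
  rewrite measureU//; first exact: measurable_in_seq.
  by apply/seteqP; split => x //= [-> h]; rewrite h in vr.
apply/seteqP; split => x /=; rewrite inE.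
  by case/orP => [/eqP|]; [left|right].
by case=> [->|->]; rewrite ?eqxx ?orbT.
Qed.

Lemma independent_reindex (I : eqType) (A : set I) (X : I -> {RV P >-> R})
    (K : finType) (f : K -> I) (B : K -> set R) :
  mutually_independent A X -> injective f -> (forall k, A (f k)) ->
  (forall k, measurable (B k)) ->
  P [set x | forall k, B k (X (f k) x)] = (\prod_k P (X (f k) @^-1` B k))%E.
Proof.
move=> ind f_inj Af mB.
(* Independence asks for a set at every index; outside the image of [f] the default is the whole
   line. *)
pose B' i := if [pick k | f k == i] is Some k then B k else setT.
have B'E k : B' (f k) = B k.
  rewrite /B'; case: pickP => [l /eqP/f_inj ->//|/(_ k)].
  by rewrite eqxx.
have := ind [seq f k | k <- enum K] B'.
rewrite map_inj_uniq// enum_uniq big_map big_enum/= => /(_ isT) h.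
rewrite (_ : [set x | _] = [set x | forall i, i \in [seq f k | k <- enum K] -> B' i (X i x)]).
  rewrite h.
  - by apply: eq_bigr => k _; rewrite B'E.
  - by move=> i /mapP[k _ ->].
  - by move=> i; rewrite /B'; case: pickP.
apply/seteqP; split => x /= h' => [i /mapP[k _ ->]|k]; first by rewrite B'E.
by rewrite -B'E; apply: h'; apply: map_f; rewrite mem_enum.
Qed.

Context {K V : finType} (X : K -> {RV P >-> R}) (pat : K -> R -> V).
Hypothesis pat_measurable : forall k v, measurable [set y | pat k y = v].
Hypothesis X_indep : forall B : K -> set R, (forall k, measurable (B k)) ->
  P [set x | forall k, B k (X k x)] = (\prod_k P (X k @^-1` B k))%E.

Definition law k v : R := fine (P (X k @^-1` [set y | pat k y = v])).

Lemma measurable_pat k v : measurable [set x | pat k (X k x) = v].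
Proof.
rewrite (_ : [set x | _] = X k @^-1` [set y | pat k y = v])//.
by rewrite -[_ @^-1` _]setTI; exact: measurable_funP.
Qed.

Lemma lawE k v : P [set x | pat k (X k x) = v] = (law k v)%:E.
Proof. by rewrite /law fineK//; apply: fin_num_measure; exact: measurable_pat. Qed.

Lemma law_ge0 k v : 0 <= law k v.
Proof. by rewrite -lee_fin -lawE. Qed.

Lemma law_sum k (A : pred V) :
  P [set x | A (pat k (X k x))] = (\sum_v law k v *+ A v)%:E.
Proof.
rewrite (_ : [set x | _] = [set x | pat k (X k x) \in enum A]).
  rewrite probability_in_seq ?enum_uniq//; last exact: measurable_pat.
  rewrite big_enum/= -sumEFin big_mkcond/=; apply: eq_bigr => v _.
  by rewrite unfold_in lawE; case: (A v).
by apply/seteqP; split => x /=; rewrite mem_enum.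
Qed.

Lemma law_sum1 k : \sum_v law k v = 1.
Proof.
apply/EFin_inj; rewrite -[RHS](probability_setT P).
have -> : [set: T] = [set x | predT (pat k (X k x))] by apply/seteqP; split.
by rewrite (law_sum k predT).
Qed.

Definition pattern x : {ffun K -> V} := [ffun k => pat k (X k x)].

Lemma patternE w : [set x | pattern x = w] = [set x | forall k, pat k (X k x) = w k].
Proof.
apply/seteqP; split => x /=; first by move=> <- k; rewrite ffunE.
by move=> h; apply/ffunP => k; rewrite ffunE.
Qed.

Lemma measurable_pattern w : measurable [set x | pattern x = w].
Proof.
rewrite patternE (_ : [set x | _] = \bigcap_(k in setT) [set x | pat k (X k x) = w k]).
  by apply: fin_bigcap_measurable => // k _; exact: measurable_pat.
by apply/seteqP; split => x /= h k; [move=> _|]; exact: h.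
Qed.

Lemma measurable_pattern_pred (A : pred {ffun K -> V}) :
  measurable [set x | A (pattern x)].
Proof.
rewrite (_ : [set x | _] = [set x | pattern x \in enum A]).
  by apply: measurable_in_seq; exact: measurable_pattern.
by apply/seteqP; split => x /=; rewrite mem_enum.
Qed.

(** Summing over the finitely many patterns, each of which has probability [weight] by
    independence. *)
Lemma pattern_prob (A : pred {ffun K -> V}) :
  P [set x | A (pattern x)] = (prob law A)%:E.
Proof.
rewrite (_ : [set x | _] = [set x | pattern x \in enum A]).
  rewrite probability_in_seq ?enum_uniq//; last exact: measurable_pattern.
  rewrite big_enum/= /prob /expect -sumEFin big_mkcond/=; apply: eq_bigr => w _.
  rewrite unfold_in; case: (A w); last by rewrite mulr0.
  rewrite mulr1 patternE (X_indep (B := fun k => [set y | pat k y = w k]))//.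
  by rewrite /weight -prodEFin; apply: eq_bigr => k _; rewrite -lawE.
by apply/seteqP; split => x /=; rewrite mem_enum.
Qed.

End FiniteValued.

(** * Uniform measure of a translated interval *)

Section UniformInterval.
Context {R : realType}.

(** The function [y |-> min y (u + 1) - min y u] is [y - u] clamped to [[0, 1]], hence
    nondecreasing. *)
Lemma min_increment_ge0 (u a a' : R) : a <= a' ->
  0 <= (Num.min a' (u + 1) - Num.min a' u) - (Num.min a (u + 1) - Num.min a u).
Proof.
move=> aa'.
rewrite !minEle; case: (leP a' (u + 1)) => ?; case: (leP a' u) => ?; try lra;
  by case: (leP a (u + 1)) => ?; case: (leP a u) => ?; lra.
Qed.

(* The right-hand side is the increment on [(a, a']] of
   [y |-> min y (g + 1) - min y g], which makes it telescope over [g]. *)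
Lemma uniform_shift_le (a a' : R) (g : nat) : a <= a' ->
  (uniform_prob (@ltr01 R) [set y : R | (a < g%:R + y <= a')%R] <=
  ((Num.min a' g.+1%:R - Num.min a' g%:R)
   - (Num.min a g.+1%:R - Num.min a g%:R))%R%:E)%E.
Proof.
move=> aa'; rewrite -natr1; move: g%:R => u.
have hi_le : Num.min 1 (a' - u) <= Num.min a' (u + 1) - Num.min a' u.
  rewrite !minEle; case: (leP 1 (a' - u)) => ?; case: (leP a' (u + 1)) => ?;
    by case: (leP a' u) => ?; lra.
have lo_ge : Num.min a (u + 1) - Num.min a u <= Num.max 0 (a - u).
  rewrite !minEle maxEle; case: (leP 0 (a - u)) => ?; case: (leP a (u + 1)) => ?;
    by case: (leP a u) => ?; lra.
pose lo := Num.max 0 (a - u); pose hi := Num.min 1 (a' - u).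
have mU : measurable [set y : R | a < u + y <= a'].
  rewrite (_ : [set y | _] = `]a - u, a' - u]%classic); first exact: measurable_itv.
  by apply/seteqP; split => y /=; rewrite in_itv/= ltrBlDl lerBrDl.
rewrite /uniform_prob integral_uniform_pdf.
set U := _ `&` _.
have mU' : measurable U by apply: measurableI => //; exact: measurable_itv.
have UI : U `<=` `[lo, hi]%classic.
  move=> y [/= /andP[h1 h2]]; rewrite !in_itv/= => /andP[y0 y1].
  rewrite ge_max le_min y0 y1/=; apply/andP; split; lra.
have -> : (\int[lebesgue_measure]_(x in U) (uniform_pdf 0 1 x)%:E)%E =
    (\int[lebesgue_measure]_(x in U) (cst 1%E x))%E :> \bar R.
  apply: eq_integral => y; rewrite inE => -[_]; rewrite /= in_itv/= => y01.
  by rewrite /uniform_pdf y01 subr0 invr1.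
rewrite integral_cst// mul1e.
apply: (@le_trans _ _ (lebesgue_measure (`[lo, hi]%classic : set R))).
  by apply: le_measure => //; rewrite inE//; exact: measurable_itv.
rewrite lebesgue_measure_itv /= lte_fin.
case: ifP => [lohi|_]; last by rewrite lee_fin min_increment_ge0.
by rewrite -EFinB lee_fin lerB.
Qed.

End UniformInterval.

Lemma sum_bool_le1 (I : finType) (B : pred I) :
  (forall k l, B k -> B l -> k = l) -> (\sum_k B k <= 1)%N.
Proof.
move=> uB; rewrite (eq_bigr (fun k => if B k then 1%N else 0%N)); last first.
  by move=> k _; case: (B k).
rewrite -big_mkcond sum1_card leqNgt; apply/negP => /card_gt1P[k [l [Bk Bl]]].
by rewrite (uB k l Bk Bl) eqxx.
Qed.

Lemma sum_bool_exists (I : finType) (B : pred I) : (\sum_k B k <= 1)%N ->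
  (\sum_k B k = [exists k, B k])%N.
Proof.
case: (boolP [exists k, B k]) => [/existsP[k Bk]|].
  by rewrite (bigD1 k)//= Bk => h; apply/eqP; rewrite eqn_leq h leq_addr.
by rewrite negb_exists => /forallP nB _; rewrite big1// => k _; rewrite (negbTE (nB k)).
Qed.

(** * Crossing patterns of the draws and probability bounds on the backlog *)

Section RandomGame.
Context d (T : measurableType d) (R : realType) (P : probability T R).
Variables (n p D i B : nat) (delta eps b : R) (s : 'I_n -> nat -> {RV P >-> R}).
Variables (sel : nat -> ('I_n -> R) -> ('I_n -> R) -> {set 'I_n}).
Variables (a0 : 'I_n -> R) (c : nat -> 'I_n -> R).
Hypotheses (D_gt1 : (1 < D)%N) (dD : delta * D%:R = 1) (p_gt0 : (0 < p)%N).
Hypotheses (eps_gt0 : 0 < eps) (eps_le : eps <= 1 / 2).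
Hypothesis draws : uniform_draws D s.
Hypothesis sel_greedy : greedy_rule p delta sel.
Hypothesis a0_water : initial_water b a0.
Hypothesis c_filler : filler p eps c.
Hypothesis B_large : b + i%:R <= B%:R.

Let D_gt0 : (0 < D)%N := ltnW D_gt1.

Let a m j := poured a0 c m j.

Let start k := (1 + k * D.+1)%N.

Let block_start_start k : block_start D (start k).
Proof. by split => //; rewrite /start addnC modnMDl. Qed.

Let s_bound x j k : block_start D k -> 0 < s j k x <= 1.
Proof. by case: draws => h _ _; exact: h. Qed.

Let a_mono j m m' : (m <= m')%N -> a m j <= a m' j.
Proof.
elim: m' => [|m' IH]; first by rewrite leqn0 => /eqP ->.
rewrite leq_eqVlt => /predU1P[-> //|/IH h].
apply: le_trans h _; rewrite /a pouredS lerDl.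
by case/andP: (pour_bound c_filler m' j).
Qed.

(** Indices are shifted: [m] stands for step [m + 1], and [t] for the threshold of rank [t + 1] in
    block [k]. *)
Definition crosses (j : 'I_n) (k : nat) (y : R) (m : nat) (t : nat) : bool :=
  a m j < (start k + t.+1)%N%:R + y <= a m.+1 j.

Definition block_steps (jk : 'I_n * 'I_B) (y : R) : {set 'I_i} :=
  [set m : 'I_i | [exists t : 'I_D, crosses jk.1 jk.2 y m t]]%SET.

(* The bound on the cardinal holds for every [block_steps jk y] (see
   [card_block_steps]); building it in makes it hold for every value. *)
Definition crosses_at (jk : 'I_n * 'I_B) (v : {set 'I_i}) : pred 'I_i :=
  fun m => (#|v| <= D)%N && (m \in v).

Lemma crosses_at_sum jk v : (\sum_m crosses_at jk v m <= D)%N.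
Proof.
rewrite /crosses_at; case: (leqP #|v| D) => [vD|_]; last by rewrite big1.
apply: leq_trans vD; rewrite -sum1_card [leqRHS]big_mkcond; apply: leq_sum => m _ /=.
by case: (m \in v).
Qed.

(** Water poured only accumulates, so each of the [D] thresholds of the block is crossed at most
    once. *)
Lemma card_block_steps jk y : (#|block_steps jk y| <= D)%N.
Proof.
have -> : (D = \sum_(t < D) 1)%N by rewrite sum1_card card_ord.
apply: (@leq_trans (\sum_(t < D) \sum_(m < i) crosses jk.1 jk.2 y m t)).
  rewrite exchange_big/= -sum1_card big_mkcond/=; apply: leq_sum => m _.
  rewrite inE; case: ifP => // /existsP[t h].
  by rewrite (bigD1 t)//= h.
apply: leq_sum => t _; apply: sum_bool_le1 => m m' /andP[h1 h2] /andP[h1' h2'].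
wlog lt : m m' h1 h2 h1' h2' / (m < m')%N => [W|].
  case: (ltngtP m m') => [h|h|/val_inj//]; first exact: W.
  by apply/esym; exact: W.
by have := a_mono jk.1 lt; rewrite leNgt (lt_le_trans h1' h2).
Qed.

Lemma measurable_block_steps jk v : measurable [set y | block_steps jk y = v].
Proof.
rewrite (_ : [set y | _] = \bigcap_(m in [set: 'I_i]) [set y | (m \in block_steps jk y) = (m \in v)]); last first.
  apply/seteqP; split => y /=; first by move=> e m _ /=; rewrite e.
  by move=> h; apply/setP => m; exact: h.
apply: fin_bigcap_measurable => // m _.
have mC : measurable [set y | m \in block_steps jk y].
  rewrite (_ : [set y | _] = \bigcup_(t in [set: 'I_D]) [set y | crosses jk.1 jk.2 y m t]).
    apply: fin_bigcup_measurable => // t _.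
    rewrite (_ : [set y | _] = `]a m jk.1 - (start jk.2 + t.+1)%N%:R,
       a m.+1 jk.1 - (start jk.2 + t.+1)%N%:R]%classic); first exact: measurable_itv.
    by apply/seteqP; split => y /=; rewrite /crosses in_itv/= ltrBlDl lerBrDl.
  apply/seteqP; split => y /=; rewrite inE.
    by move=> /existsP[t h]; exists t.
  by move=> [t _ h]; apply/existsP; exists t.
case: (m \in v) => //.
rewrite (_ : [set y | _] = ~` [set y | m \in block_steps jk y]); first exact: measurableC.
by apply/seteqP; split => y /=; case: (m \in _).
Qed.

Let draw (jk : 'I_n * 'I_B) : {RV P >-> R} := s jk.1 (start jk.2).

Let mu := law draw block_steps.

Let mu_ge0 jk v : 0 <= mu jk v.
Proof. exact: (law_ge0 draw measurable_block_steps jk v). Qed.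

Let mu_sum1 jk : \sum_v mu jk v = 1.
Proof. exact: (law_sum1 draw measurable_block_steps jk). Qed.

Lemma draw_indep (Q : 'I_n * 'I_B -> set R) : (forall jk, measurable (Q jk)) ->
  P [set x | forall jk, Q jk (draw jk x)] = (\prod_jk P (draw jk @^-1` Q jk))%E.
Proof.
move=> mQ; have [_ _ ind] := draws.
apply: (@independent_reindex _ _ _ _ _ _ _ _ (fun jk : 'I_n * 'I_B => (jk.1, start jk.2)) Q ind) => //; last first.
  by move=> jk; exact: block_start_start.
move=> [j k] [j' k'] /= [-> ].
by move/eqP; rewrite eqn_pmul2r// => /eqP/val_inj ->.
Qed.

Let incr m j g : R := (Num.min (a m.+1 j) g.+1%:R - Num.min (a m.+1 j) g%:R)
   - (Num.min (a m j) g.+1%:R - Num.min (a m j) g%:R).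

Lemma prob_crosses (jk : 'I_n * 'I_B) (m t : nat) :
  (P [set x | crosses jk.1 jk.2 (draw jk x) m t] <=
   (incr m jk.1 (start jk.2 + t.+1)%N)%:E)%E.
Proof.
rewrite /crosses; move: (start jk.2 + t.+1)%N => g; apply: le_trans (uniform_shift_le g (a_mono jk.1 (leqnSn m))).
have [_ unif _] := draws.
have mI : measurable [set y : R | a m jk.1 < g%:R + y <= a m.+1 jk.1].
  rewrite (_ : [set y | _] = `]a m jk.1 - g%:R, a m.+1 jk.1 - g%:R]%classic).
    exact: measurable_itv.
  by apply/seteqP; split => y /=; rewrite in_itv/= ltrBlDl lerBrDl.
by rewrite -(unif jk.1 (start jk.2) _ (block_start_start _) mI).
Qed.

Let incr_ge0 m j g : 0 <= incr m j g.
Proof.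
by rewrite /incr -natr1; apply: min_increment_ge0; exact: a_mono.
Qed.

(** Levels reached by step [i] are at most [b + i <= B <= G], so the first [B] blocks of each cup
    contain every threshold crossed so far. *)
Let G := (B * D.+1).+1.

Let a_le m j : (m <= i)%N -> a m j <= G%:R.
Proof.
move=> mi; have /andP[_ h] := poured_bound a0_water c_filler m j.
apply: le_trans h _; apply: le_trans (_ : b + i%:R <= _).
  by rewrite lerD2l ler_nat.
apply: le_trans B_large _; rewrite ler_nat /G; nia.
Qed.

(** A union bound over the thresholds of each block; the bounds [incr] then telescope, for each cup,
    to the water poured into it. *)
Lemma crossing_mean (m : 'I_i) :
  \sum_jk \sum_v mu jk v *+ crosses_at jk v m <= (1 - eps) * p%:R.
Proof.
refine (@le_trans _ _ (\sum_(jk : 'I_n * 'I_B) \sum_(t < D) incr m jk.1 (start jk.2 + t.+1)%N) _ _ _ _).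
  apply: ler_sum => jk _.
  apply: (@le_trans _ _ (\sum_v mu jk v *+ (m \in v))).
    apply: ler_sum => v _; rewrite /crosses_at.
    case: (_ <= _)%N => //=; rewrite mulr0n mulrn_wge0//; exact: mu_ge0.
  suff : ((\sum_v mu jk v *+ (m \in v))%:E <=
      (\sum_(t < D) incr m jk.1 (start jk.2 + t.+1)%N)%:E)%E by rewrite lee_fin.
  rewrite -(law_sum draw measurable_block_steps jk (fun v => m \in v)).
  have mE t : measurable [set x | crosses jk.1 jk.2 (draw jk x) m t].
    rewrite (_ : [set x | _] = draw jk @^-1` `]a m jk.1 - (start jk.2 + t.+1)%N%:R,
       a m.+1 jk.1 - (start jk.2 + t.+1)%N%:R]%classic).
      by rewrite -[_ @^-1` _]setTI; exact: measurable_funP.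
    by apply/seteqP; split => y /=; rewrite /crosses in_itv/= ltrBlDl lerBrDl.
  apply: (@le_trans _ _ (\sum_(t < D) P [set x | crosses jk.1 jk.2 (draw jk x) m t])%E).
    rewrite (_ : [set x | _] = \big[setU/set0]_(t < D) [set x | crosses jk.1 jk.2 (draw jk x) m t]).
      apply: (Boole_inequality P (A := fun t => [set x | crosses jk.1 jk.2 (draw jk x) m t])) => t _.
      exact: mE.
    rewrite -(bigcup_mkord D (fun t => [set x | crosses jk.1 jk.2 (draw jk x) m t])).
    apply/seteqP; split => x /=; rewrite inE.
      by move=> /existsP[t h]; exists t => //=.
    by move=> [t /= tD h]; apply/existsP; exists (Ordinal tD).
  by rewrite -sumEFin; apply: lee_sum => t _; exact: prob_crosses.
have [c01 csum] := c_filler (ltn0Sn m).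
refine (le_trans _ csum).
rewrite -(pair_bigA _ (fun j (k : 'I_B) => \sum_(t < D) incr m j (start k + t.+1)%N))/=.
apply: ler_sum => j _.
rewrite -(big_threshold_index +%R D B (incr m j)) big_mkcond/=.
apply: (@le_trans _ _ (\sum_(0 <= g < G) incr m j g)).
  by apply: ler_sum => g _; case: ifP => // _; exact: incr_ge0.
rewrite /incr sumrB !telescope_sumr//.
have /andP[h0 _] := poured_bound a0_water c_filler m j.
have /andP[h0' _] := poured_bound a0_water c_filler m.+1 j.
rewrite (min_l (a_le j (ltnW (ltn_ord m)))) (min_l (a_le j (ltn_ord m))).
rewrite (min_r h0) (min_r h0') !subr0 /a pouredS; lra.
Qed.

Let sx x j k : R := s j k x.

(** A cup crosses at most one threshold per step, so counting crossed thresholds amounts to counting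
    blocks with a crossing. *)
Lemma crossed_crossings x (m : 'I_i) :
  (\sum_j crossed D (sx x) a0 c m.+1 j =
   crossings crosses_at m (pattern draw block_steps x))%N.
Proof.
rewrite /crossings [RHS](eq_bigr (fun jk : 'I_n * 'I_B =>
  nat_of_bool (crosses_at (jk.1, jk.2) (pattern draw block_steps x (jk.1, jk.2)) m))); last by case.
rewrite -(pair_bigA _ (fun j k => nat_of_bool (crosses_at (j, k) (pattern draw block_steps x (j, k)) m)))/=.
apply: eq_bigr => j _.
rewrite /crossed (nb_crossedE (s_bound x) j (a m j) (a_le j (ltn_ord m))).
have := count_thresholds_le1 (@s_bound x j) G (a := a m j) (a' := a m.+1 j).
rewrite /a pouredS lerD2l; case/andP: (pour_bound c_filler m j) => _ -> /(_ isT).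
rewrite -pouredS -/(a _ _) count_thresholds_blocks => le1.
apply: eq_bigr => k _; rewrite /crosses_at ffunE card_block_steps inE /=.
rewrite -sum_bool_exists//.
by apply: leq_trans le1; rewrite (bigD1 k)//= leq_addr.
Qed.

Lemma sum_arrivals x t :
  (\sum_((i - t).+1 <= m < i.+1) arrivals p D (sx x) a0 c m =
   excess crosses_at D p (last_steps i t) (pattern draw block_steps x))%N.
Proof.
rewrite big_add1/=.
pose F m := arrivals p D (sx x) a0 c m.+1.
rewrite -(@sum_last_steps i t F) /excess; apply: eq_bigr => m _.
by rewrite /F /arrivals crossed_crossings.
Qed.

Hypotheses (i_gt0 : (0 < i)%N) (b_le : 2 * b / delta <= i%:R).
Hypothesis small :
  D.+1%:R * (4 / eps * expR (- (eps ^+ 2 * p%:R / 8))) <= 1 / 4.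

Let final_backlog x := backlog (state_after D delta (fun j m => s j m x) a0 c sel i).

Let few_excess_backlog x L :
  few_excess crosses_at D p L (pattern draw block_steps x) ->
  (2 * \sum_(1 <= m < i.+1) arrivals p D (sx x) a0 c m < i)%N /\
  (forall t, (L <= t)%N -> (t < i)%N ->
    2 * \sum_((i - t).+1 <= m < i.+1) arrivals p D (sx x) a0 c m < t)%N.
Proof.
case/andP=> h1 /forallP h2; split.
  by have := sum_arrivals x i; rewrite subnn => ->.
move=> t Lt ti; rewrite sum_arrivals.
by have := h2 (Ordinal ti); rewrite Lt.
Qed.

(** The event on the pattern is measurable and serves as inner approximation of [S]. *)
Lemma prob_at_least_pred (A : pred {ffun 'I_n * 'I_B -> {set 'I_i}}) (S : set T) (q : R) :
  (forall x, A (pattern draw block_steps x) -> S x) ->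
  prob mu (fun w => ~~ A w) <= q -> prob_at_least P S (1 - q).
Proof.
move=> AS Aq; exists [set x | A (pattern draw block_steps x)]; split.
- exact: (measurable_pattern_pred draw measurable_block_steps A).
- exact: AS.
- rewrite (pattern_prob measurable_block_steps draw_indep) lee_fin.
  by move: Aq; rewrite prob_setC//; rewrite -/mu; lra.
Qed.

Lemma prob_backlog_le_ln L :
  prob_at_least P [set x | final_backlog x <= 5 + 2 / eps * ln (1 + (L * p)%:R)]
    (1 - ((rate D p + 1) * expR (- (L%:R / rate D p)) + expR (- (i%:R / rate D p)))).
Proof.
apply: (@prob_at_least_pred (few_excess crosses_at D p L)).
  move=> x /few_excess_backlog[h1 h2].
  exact: (backlog_le_ln D_gt1 dD eps_gt0 eps_le (s_bound x) sel_greedy a0_water c_filler i_gt0 b_le h1 h2).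
exact: (prob_not_few_excess mu_ge0 mu_sum1 D_gt0 p_gt0 eps_gt0 eps_le crosses_at_sum crossing_mean small).
Qed.

Lemma prob_backlog_le3 L :
  prob_at_least P [set x | final_backlog x <= 3]
    (1 - ((rate D p + 1) * expR (- (L%:R / rate D p)) + expR (- (i%:R / rate D p))
          + L%:R * expR (- (eps ^+ 2 * p%:R / 8)))).
Proof.
apply: (@prob_at_least_pred (fun w => few_excess crosses_at D p L w && few_crossings crosses_at p L w)).
  move=> x /andP[/few_excess_backlog[h1 h2] /forallP h3].
  apply: (backlog_le3 D_gt1 dD eps_gt0 eps_le (s_bound x) sel_greedy a0_water c_filler i_gt0 b_le h1 h2) => m Lm mi.
  case: m Lm mi => // m Lm mi.
  have := h3 (Ordinal mi); rewrite inE /= -ltnS Lm /= => h.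
  by have := crossed_crossings x (Ordinal mi); move=> /= ->.
apply: (@le_trans _ _ (prob mu (fun w => ~~ few_excess crosses_at D p L w) +
   prob mu (fun w => ~~ few_crossings crosses_at p L w))).
  rewrite /prob -expectD; apply: le_expect => // w.
  by case: (few_excess _ _ _ _ _); case: (few_crossings _ _ _ _); rewrite /= ?addr0 ?add0r ?lerDl//.
apply: lerD.
  exact: (prob_not_few_excess mu_ge0 mu_sum1 D_gt0 p_gt0 eps_gt0 eps_le crosses_at_sum crossing_mean small).
exact: (prob_not_few_crossings mu_ge0 mu_sum1 eps_gt0 eps_le crossing_mean).
Qed.

End RandomGame.

(** * Choice of the constants *)

Lemma prob_at_least_sub d (T : measurableType d) (R : realType) (P : probability T R)
    (A A' : set T) (q q' : R) : A `<=` A' -> q' <= q ->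
  prob_at_least P A q -> prob_at_least P A' q'.
Proof.
move=> AA' qq' [E [mE EA qE]]; exists E; split => //.
  exact: subset_trans AA'.
by apply: le_trans qE; rewrite lee_fin.
Qed.

Section Constants.
Context {R : realType} (p D : nat) (eps delta : R).
Hypotheses (p_gt0 : (0 < p)%N) (D_gt0 : (0 < D)%N).
Hypotheses (eps_ge : p%:R `^ (- (1 / 3)) <= eps) (eps_le : eps <= 1 / 2).
Hypotheses (dD : delta * D%:R = 1).
Hypothesis delta_ge : 512 * expR (- (1 / 64 * eps ^+ 2 * p%:R)) <= delta.

(** The estimates below are expressed through [y]: [eps >= p^(-1/3)] gives [1 / eps <= y] and
    [p <= y^3]. *)
Let y := eps ^+ 2 * p%:R.

Let pR : 0 < p%:R :> R. Proof. by rewrite ltr0n. Qed.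

Lemma eps_gt0 : 0 < eps.
Proof. by apply: lt_le_trans eps_ge; rewrite powR_gt0. Qed.

Lemma eps_cube : 1 <= eps ^+ 3 * p%:R.
Proof.
have h : p%:R^-1 <= eps ^+ 3.
  have -> : p%:R^-1 = (p%:R `^ (- (1 / 3))) ^+ 3 :> R.
    rewrite -(powR_mulrn _ (powR_ge0 _ _)) -powRrM.
    have -> : - (1 / 3) * 3%:R = -1 :> R by field.
    by rewrite powR_inv1// ltW.
  by rewrite lerXn2r ?nnegrE ?powR_ge0// ltW// eps_gt0.
by have := ler_wpM2r (ltW pR) h; rewrite mulVf ?gt_eqF.
Qed.

Lemma invr_eps_le : eps^-1 <= y.
Proof.
have e0 := eps_gt0; rewrite -(ler_pM2l e0) mulfV ?gt_eqF// /y.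
by apply: le_trans eps_cube _; rewrite exprSr mulrA [eps * eps ^+ 2]mulrC.
Qed.

Lemma ln_p_ge1 : 1 <= ln (p%:R : R).
Proof.
have e0 := eps_gt0; have e2 := eps_le.
have h2 : eps ^+ 2 <= 1 / 4.
  by rewrite expr2; have := ler_pM (ltW e0) (ltW e0) e2 e2; lra.
have h3 : eps ^+ 3 <= 1 / 4.
  by rewrite exprSr; have := ler_pM (sqr_ge0 eps) (ltW e0) h2 e2; lra.
have p4 : 4 <= p%:R :> R.
  by have := ler_wpM2r (ltW pR) h3; have := eps_cube; lra.
have e4 : expR 1 <= 4 :> R.
  have h : expR (1 / 2) <= 2 :> R by apply: le_trans (expR_le_quadratic (lexx _)) _; lra.
  have -> : 1 = 1 / 2 + 1 / 2 :> R by field.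
  by rewrite expRD; have := ler_pM (expR_ge0 _) (expR_ge0 _) h h; lra.
by rewrite -[leLHS]expRK ler_ln ?posrE ?expR_gt0// (le_trans e4).
Qed.

Lemma y_le : y <= p%:R.
Proof.
have e0 := eps_gt0.
rewrite /y ler_piMl// expr_le1//; first by have := eps_le; lra.
exact: ltW.
Qed.

Lemma y_ge1 : 1 <= y.
Proof.
apply: le_trans invr_eps_le; have e0 := eps_gt0; have := eps_le.
by rewrite invf_ge1//; lra.
Qed.

Lemma p_le_y : p%:R <= y ^+ 3.
Proof.
have h := eps_cube.
have -> : y ^+ 3 = (eps ^+ 3 * p%:R) ^+ 2 * p%:R by rewrite /y; ring.
by rewrite ler_peMl// exprn_ege1.
Qed.

Lemma D_le : 512 * D%:R <= expR (y / 64).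
Proof.
have D0 : 0 < D%:R :> R by rewrite ltr0n.
have := ler_wpM2r (ltW D0) delta_ge; rewrite dD.
have -> : 1 / 64 * eps ^+ 2 * p%:R = y / 64 by rewrite /y; ring.
move=> h; have := ler_wpM2r (expR_ge0 (y / 64)) h.
have e : expR (- (y / 64)) * expR (y / 64) = 1 by rewrite -expRD addNr expR0.
have <- : 512 * expR (- (y / 64)) * D%:R * expR (y / 64) = 512 * D%:R.
  by rewrite -[X in _ = X]mulr1 -[X in _ = _ * X]e; ring.
by rewrite mul1r in h *.
Qed.

(** The factor [expR (- y / 8)] absorbs [256 (D + 1) <= expR (y / 64)] and
    [1 / eps <= y <= 16 expR (y / 16)]; the constant 512 in [delta_ge] yields exactly [1 / 4]. *)
Lemma small_drift :
  D.+1%:R * (4 / eps * expR (- (eps ^+ 2 * p%:R / 8))) <= 1 / 4.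
Proof.
have D0 : 1 <= D%:R :> R by rewrite ler1n.
have y1 := y_ge1; rewrite -/y.
have h0 : 0 <= D.+1%:R :> R by [].
have h1 : D.+1%:R <= 2 * D%:R :> R by rewrite -natr1; lra.
have h2 : D.+1%:R * 256 <= expR (y / 64).
  by apply: le_trans D_le; lra.
have h3 : y / 16 <= expR (y / 16) := expR_ge_lin _.
have h4 : 4 / eps <= 4 * y by rewrite ler_wpM2l// invr_eps_le.
have h5 : expR (y / 64) * expR (y / 16) * expR (- (y / 8)) <= 1.
  rewrite -!expRD -[leRHS]expR0 ler_expR; lra.
have e8 := expR_ge0 (- (y / 8)).
have h6 : (D.+1%:R * 256) * (y / 16) <= expR (y / 64) * expR (y / 16).
  have D2 : 0 <= D.+1%:R * 256 :> R by lra.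
  have y2 : 0 <= y / 16 by lra.
  exact: ler_pM D2 y2 h2 h3.
have h7 := ler_wpM2r e8 h6.
have h8 : D.+1%:R * (4 / eps * expR (- (y / 8))) <= D.+1%:R * (4 * y * expR (- (y / 8))).
  by rewrite ler_wpM2l// ler_wpM2r.
lra.
Qed.

Let Q : R := rate D p.

Lemma rate_ge1 : 1 <= Q.
Proof. by rewrite /Q /rate -natrX -!natrM ler1n 2!muln_gt0 expn_gt0 D_gt0 p_gt0. Qed.

(** Here [D^4 <= expR (y / 16)] and [p^2 <= y^6 <= 192^6 expR (y / 32)], which leaves
    [expR (- y / 32)]. *)
Lemma steps_le : Q * p%:R * expR (- (y / 8)) <= 4096 * 192 ^+ 6 * expR (- (y / 32)).
Proof.
have D0 : 0 <= D%:R :> R by [].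
have y1 := y_ge1.
have hD : D%:R ^+ 4 <= expR (y / 16).
  have -> : y / 16 = 4%:R * (y / 64) by field.
  rewrite expRM_natl lerXn2r ?nnegrE ?expR_ge0//.
  by apply: le_trans D_le; lra.
have hp : p%:R ^+ 2 <= 192 ^+ 6 * expR (y / 32).
  have -> : y / 32 = 6%:R * (y / 192) by field.
  rewrite expRM_natl -exprMn.
  apply: (@le_trans _ _ (y ^+ 6)).
    rewrite (exprM y 3 2); apply: lerXn2r; rewrite ?nnegrE ?p_le_y//.
    by rewrite exprn_ge0//; lra.
  have h := expR_ge_lin (y / 192).
  by apply: lerXn2r; rewrite ?nnegrE; lra.
move: (192 ^+ 6 : R) hp => K hp.
have h : Q * p%:R * expR (- (y / 8)) = 4096 * (D%:R ^+ 4 * p%:R ^+ 2) * expR (- (y / 8)).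
  by rewrite /Q /rate; ring.
rewrite {}h.
have h : D%:R ^+ 4 * p%:R ^+ 2 <= expR (y / 16) * (K * expR (y / 32)).
  by apply: ler_pM => //; rewrite exprn_ge0.
have {}h := ler_wpM2r (expR_ge0 (- (y / 8))) h.
have e : expR (y / 16) * (K * expR (y / 32)) * expR (- (y / 8)) =
    K * expR (- (y / 32)).
  transitivity (K * (expR (y / 16) * expR (y / 32) * expR (- (y / 8)))); first by ring.
  by rewrite -!expRD; congr (_ * expR _); field.
rewrite e in h; rewrite -[leLHS]mulrA -[leRHS]mulrA.
exact: (ler_wpM2l (ler0n R 4096) h).
Qed.

(** With [r = D^4 p] the hypothesis reads [r^2 <= i], so [i / Q = i / (4096 r)] is at least
    [sqrt i / 4096]. *)
Lemma expR_rate_le (i : nat) : delta ^- 8 * p%:R ^+ 2 <= i%:R ->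
  expR (- (i%:R / Q)) <= expR (- (1 / 4096 * i%:R `^ (1 / 6))).
Proof.
have D1 : 1 <= D%:R :> R by rewrite ler1n.
have p1 : 1 <= p%:R :> R by rewrite ler1n.
have dE : delta^-1 = D%:R.
  have d0 : delta != 0 by apply/eqP => d0; move: dD; rewrite d0 mul0r => /eqP; rewrite eq_sym oner_eq0.
  by apply: (mulfI d0); rewrite mulfV.
rewrite -exprVn dE => hi.
pose r : R := D%:R ^+ 4 * p%:R.
have r1 : 1 <= r by rewrite mulr_ege1// exprn_ege1.
have ri : r ^+ 2 <= i%:R by rewrite /r exprMn -exprM.
have i1 : 1 <= i%:R :> R by apply: le_trans ri; rewrite exprn_ege1.
rewrite ler_expR lerN2.
pose z : R := i%:R `^ (1 / 2).
have z2 : z ^+ 2 = i%:R.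
  rewrite /z -powR_mulrn ?powR_ge0// -powRrM.
  have -> : 1 / 2 * 2%:R = 1 :> R by field.
  by rewrite powRr1.
have z0 : 0 <= z by exact: powR_ge0.
have rz : r <= z by rewrite -(@ler_pXn2r _ 2)// ?nnegrE// ?z2//; lra.
have h6 : i%:R `^ (1 / 6) <= z by rewrite ler_powR//; lra.
have QE : Q = 4096 * r by rewrite /Q /rate /r mulrA.
have r0 : 0 < r by apply: lt_le_trans r1; exact: ltr01.
rewrite QE -[X in _ <= X / _]z2.
have -> : z ^+ 2 / (4096 * r) = 1 / 4096 * (z ^+ 2 / r).
  by field; rewrite (lt0r_neq0 r0).
have c0 : 0 <= 1 / 4096 :> R := divr_ge0 ler01 (ler0n R 4096).
apply: (ler_wpM2l c0); rewrite ler_pdivlMr// expr2.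
exact: (ler_pM (powR_ge0 _ _) (ltW r0) h6 rz).
Qed.

(** Since [L / Q >= p >= y / 8], each term is at most [2 Q p expR (- y / 8)]. *)
Lemma overflow_le (L : nat) : Q * p%:R <= L%:R -> L%:R <= Q * p%:R + 1 ->
  (Q + 1) * expR (- (L%:R / Q)) + L%:R * expR (- (y / 8)) <=
  4 * (4096 * 192 ^+ 6) * expR (- (y / 32)).
Proof.
have Q1 := rate_ge1; have p1 : 1 <= p%:R :> R by rewrite ler1n.
have h := steps_le; have yp := y_le; have y1 := y_ge1.
move=> L1 L2; move: h; set M := 4096 * 192 ^+ 6; move: M => M h.
move: Q Q1 L1 L2 h => q q1 L1 L2 h; have q0 : 0 < q by lra.
have E0 := expR_ge0 (- (y / 8)).
have h1 : expR (- (L%:R / q)) <= expR (- (y / 8)).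
  rewrite ler_expR lerN2; apply: (@le_trans _ _ p%:R); first by lra.
  by rewrite ler_pdivlMr// mulrC.
have qp : q <= q * p%:R by rewrite ler_peMr// ltW.
have h2 : q + 1 <= 2 * (q * p%:R) by lra.
have h3 : L%:R <= 2 * (q * p%:R) by lra.
have q2 : 0 <= q + 1 by lra.
have h4 := ler_pM q2 (expR_ge0 _) h2 h1.
have h5 := ler_wpM2r E0 h3.
have : 4 * (q * p%:R * expR (- (y / 8))) <= 4 * (M * expR (- (y / 32))).
  exact: (ler_wpM2l (ler0n R 4) h).
lra.
Qed.

(** * Estimates in [expR k] for polynomially small [delta] *)

Section PolynomialDelta.
Variables (c k : R).
Hypotheses (c_gt0 : 0 < c) (delta_poly : p%:R `^ (- c) <= delta) (k_ge : ln p%:R <= k).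

Lemma k_ge1 : 1 <= k.
Proof. exact: le_trans ln_p_ge1 k_ge. Qed.

Lemma p_le_expR : p%:R <= expR k.
Proof. by rewrite -[leLHS](@lnK R) ?posrE// ler_expR. Qed.

Lemma D_le_expR : D%:R <= expR (c * k).
Proof.
have D0 : 0 <= D%:R :> R by [].
have h := ler_wpM2r D0 delta_poly; rewrite dD /powR gt_eqF// in h.
apply: (@le_trans _ _ (expR (c * ln p%:R))); last first.
  by rewrite ler_expR ler_wpM2l// ltW.
have := ler_wpM2l (expR_ge0 (c * ln p%:R)) h.
by rewrite mulr1 mulrA -expRD mulNr subrr expR0 mul1r.
Qed.

Lemma rate_le_expR : Q <= 4096 * expR ((4 * c + 1) * k).
Proof.
have -> : Q = 4096 * (D%:R ^+ 4 * p%:R) by rewrite /Q /rate mulrA.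
apply: (ler_wpM2l (ler0n R 4096)).
have -> : (4 * c + 1) * k = 4%:R * (c * k) + k by ring.
rewrite expRD expRM_natl.
have D0 : 0 <= D%:R :> R by [].
apply: (ler_pM (exprn_ge0 4 D0) (ltW pR) _ p_le_expR).
by apply: lerXn2r; rewrite ?nnegrE ?expR_ge0// D_le_expR.
Qed.

(* The tangent of [expR] at [ln N]. *)
Lemma mulr_le_expR (N x : R) : 0 < N -> N * x <= expR x + N * ln N.
Proof.
move=> N0; have -> : expR x = N * expR (x - ln N).
  by rewrite expRB lnK ?posrE// mulrC divfK ?gt_eqF.
have h := ler_wpM2l (ltW N0) (expR_ge1Dx (x - ln N)).
lra.
Qed.

(** The window gives [expR (- 2 expR k)]. One of the two terms [expR k] absorbs the factor
    [expR ((4 c + 1) k)] from [Q], up to a constant depending on [c]. *)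
Lemma tail_le (L : nat) : Q * (2 * expR k) <= L%:R ->
  (Q + 1) * expR (- (L%:R / Q)) <=
  2 * 4096 * expR ((4 * c + 1) * ln (4 * c + 1)) * expR (- expR k).
Proof.
have Q1 := rate_ge1; have hQ := rate_le_expR.
move: Q Q1 hQ => q q1 hq; have q0 : 0 < q by lra.
move: (4096 : R) hq => K hq hL.
have N0 : 0 < 4 * c + 1 by have := c_gt0; lra.
have h1 : expR (- (L%:R / q)) <= expR (- (2 * expR k)).
  by rewrite ler_expR lerN2 ler_pdivlMr// mulrC.
have h2 : q + 1 <= 2 * (K * expR ((4 * c + 1) * k)) by lra.
have q2 : 0 <= q + 1 by lra.
apply: le_trans (ler_pM q2 (expR_ge0 _) h2 h1) _.
have K0 : 0 <= 2 * K.
  have : 0 <= K * expR ((4 * c + 1) * k) by lra.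
  by rewrite pmulr_lge0 ?expR_gt0// => ?; lra.
have -> : 2 * (K * expR ((4 * c + 1) * k)) * expR (- (2 * expR k)) =
  2 * K * (expR ((4 * c + 1) * k) * expR (- (2 * expR k))) by ring.
rewrite -[leRHS]mulrA ler_wpM2l// -!expRD ler_expR.
by have := mulr_le_expR k N0; lra.
Qed.

(** [1 + L p] is at most [4 Q expR k p]. The exponent [4 c + 3] collects [4 c + 1] from [Q] and 1
    each from [expR k] and [p]; [k >= 1] and [1 / eps >= 1] absorb additive constants. *)
Lemma backlog_bound_le (L : nat) : L%:R <= Q * (2 * expR k) + 1 ->
  5 + 2 / eps * ln (1 + (L * p)%:R) <=
  (5 + 2 * (ln (4 * 4096) + (4 * c + 3))) * k / eps.
Proof.
have Q1 := rate_ge1; have hQ := rate_le_expR; have k1 := k_ge1.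
have hp := p_le_expR; have e0 := eps_gt0.
have p1 : 1 <= p%:R :> R by rewrite ler1n.
have K1 : 1 <= 4096 :> R by rewrite (ler_nat R 1 4096).
rewrite natrM.
move: Q Q1 hQ => q q1 hq; move: (4096 : R) K1 hq => K K1 hq hL.
have c0 := c_gt0.
have ek : 1 <= expR k by have := expR_ge1Dx k; lra.
have qp : 1 <= q * expR k * p%:R by rewrite !mulr_ege1.
have h1 : 1 + L%:R * p%:R <= 4 * (q * expR k * p%:R).
  have := ler_wpM2r (ltW (lt_le_trans ltr01 p1)) hL.
  have : p%:R <= q * expR k * p%:R by rewrite ler_peMl// mulr_ege1.
  lra.
have h2 : 4 * (q * expR k * p%:R) <= 4 * K * expR ((4 * c + 3) * k).
  have -> : (4 * c + 3) * k = (4 * c + 1) * k + k + k by ring.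
  rewrite !expRD -[leRHS]mulrA ler_wpM2l// !mulrA.
  apply: ler_pM => //; last by apply: ler_pM => //; lra.
  by rewrite mulr_ge0//; lra.
have K4 : 0 < 4 * K by lra.
have L0 : 0 < 1 + L%:R * p%:R :> R by rewrite ltr_pwDl// mulr_ge0.
have h3 : ln (1 + L%:R * p%:R) <= (ln (4 * K) + (4 * c + 3)) * k.
  apply: (@le_trans _ _ (ln (4 * K * expR ((4 * c + 3) * k)))).
    by rewrite ler_ln ?posrE// ?(le_trans h1 h2)// mulr_gt0// expR_gt0.
  rewrite lnM ?posrE ?expR_gt0// expRK [leRHS]mulrDl lerD2r ler_peMr// ln_ge0//; lra.
have ei : 2 <= eps^-1.
  by rewrite -[leLHS]invrK lef_pV2 ?posrE ?invr_gt0//; have := eps_le; lra.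
have e2 : 0 <= 2 / eps by rewrite mulr_ge0// invr_ge0 ltW.
have h4 := ler_wpM2l e2 h3.
have h5 : 5 <= 5 * k / eps.
  have := ler_pM ler01 ler01 k1 (le_trans _ ei : 1 <= eps^-1); rewrite mulr1; lra.
lra.
Qed.

End PolynomialDelta.

End Constants.

Theorem theorem9p2 (R : realType) :
  exists alpha beta gamma eta C : R,
    [/\ 0 < alpha, 0 < beta, 0 < gamma, 0 < eta & 0 < C] /\
    forall c : R, 0 < c ->
    exists C1 C2 eta' : R,
      [/\ 0 < C1, 0 < C2 & 0 < eta'] /\
      forall (n p D : nat) (b eps delta : R),
        (1 <= n)%N -> (1 <= p)%N -> 0 <= b ->
        p%:R `^ (- (1 / 3)) <= eps -> eps <= 1 / 2 ->
        alpha * expR (- (beta * eps ^+ 2 * p%:R)) <= delta -> delta < 1 ->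
        1 / delta = D%:R ->
      forall (d : measure_display) (T : measurableType d)
        (P : probability T R) (s : 'I_n -> nat -> {RV P >-> R})
        (sel : nat -> ('I_n -> R) -> ('I_n -> R) -> {set 'I_n})
        (a0 : 'I_n -> R) (pour : nat -> 'I_n -> R) (i : nat),
        uniform_draws D s ->
        greedy_rule p delta sel ->
        initial_water b a0 ->
        filler p eps pour ->
        delta ^- 8 * p%:R ^+ 2 <= i%:R ->
        2 * b / delta <= i%:R ->
      let backlog_after_i (x : T) : R :=
        backlog (state_after D delta (fun j m => s j m x) a0 pour sel i) in
      prob_at_least P [set x | backlog_after_i x <= 3]
        (1 - C * expR (- (gamma * eps ^+ 2 * p%:R))
           - C * expR (- (eta * i%:R `^ (1 / 6)))) /\
      (p%:R `^ (- c) <= delta ->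
       forall k : R, ln p%:R <= k ->
       prob_at_least P [set x | backlog_after_i x <= C1 * k / eps]
         (1 - C2 * expR (- expR k) - C2 * expR (- (eta' * i%:R `^ (1 / 6))))).
Proof.
pose M : R := 4 * (4096 * 192 ^+ 6).
have M0 : 0 <= M.
  by apply: mulr_ge0; [exact: ler0n|apply: mulr_ge0; [exact: ler0n|exact/exprn_ge0/ler0n]].
have eta0 : 0 < 1 / 4096 :> R := divr_gt0 ltr01 (ltr0Sn R 4095).
(* [M] comes from [overflow_le]; the added 1 covers the term [expR (- i / Q)]. *)
exists 512, (1 / 64), (1 / 32), (1 / 4096), (1 + M); split.
  split; [exact: ltr0Sn|exact: divr_gt0|exact: divr_gt0|exact: eta0|].
  by rewrite ltr_pwDl.
move=> c c0.
pose M2 : R := 2 * 4096 * expR ((4 * c + 1) * ln (4 * c + 1)).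
have M20 : 0 <= M2.
  apply: mulr_ge0; last exact: expR_ge0.
  by apply: mulr_ge0; exact: ler0n.
pose C1 : R := 5 + 2 * (ln (4 * 4096) + (4 * c + 3)).
have C10 : 0 < C1.
  have K1 : 1 <= 4096 :> R by rewrite (ler_nat R 1 4096).
  rewrite /C1; move: (4096 : R) K1 => K K1.
  have h1 : 1 <= 4 * K by move: K1; clear; lra.
  by move: (ln_ge0 h1) c0; clear; lra.
exists C1, (1 + M2), (1 / 4096); split.
  by split => //; rewrite ltr_pwDl.
move=> n p D b eps delta n1 p1 b0 eps_ge eps_le delta_ge delta1 dD.
move=> d T P s sel a0 pour i draws greedy water fill i_ge i_ge2 backlog_after_i.
have p0 : 0 < p%:R :> R by rewrite ltr0n.
have d0 : 0 < delta.
  by apply: lt_le_trans delta_ge; apply: mulr_gt0; [exact: ltr0Sn|exact: expR_gt0].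
have dD1 : delta * D%:R = 1 by rewrite -dD mul1r mulfV ?gt_eqF.
(* [delta < 1] excludes [D = 1], so [delta <= 1 / 2]. *)
have D1 : (1 < D)%N.
  by rewrite -(ltr_nat R) -dD div1r invf_gt1.
have D0 := ltnW D1.
have i0 : (0 < i)%N.
  rewrite -(ltr_nat R); apply: lt_le_trans i_ge.
  by rewrite mulr_gt0 ?exprn_gt0// invr_gt0 exprn_gt0.
have e0 := eps_gt0 p1 eps_ge.
have [B hB] := nat_ubound (b + i%:R).
have sm := small_drift p1 D0 eps_ge eps_le dD1 delta_ge.
have Q1 : 1 <= rate D p :> R := rate_ge1 p1 D0.
have ri := expR_rate_le p1 D0 dD1 i_ge.
have eta_i : 0 <= expR (- (1 / 4096 * i%:R `^ (1 / 6))) :> R := expR_ge0 _.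
split.
  (* Just above [Q p]: long enough for the queue to have emptied, short enough for a union bound on
     the steps with more than [p] crossings. *)
  pose L := (Num.truncn (rate D p * p%:R : R)).+1.
  have /andP[L1 L2] := truncn_itv (mulr_ge0 (le_trans ler01 Q1) (ltW p0)).
  have hL1 : rate D p * p%:R <= L%:R :> R by exact: ltW.
  have hL2 : L%:R <= rate D p * p%:R + 1 :> R by rewrite -natr1 lerD2r.
  have := prob_backlog_le3 D1 dD1 p1 e0 eps_le draws greedy water fill hB i0 i_ge2 sm L.
  apply: prob_at_least_sub => //.
  have := overflow_le p1 D0 eps_ge eps_le dD1 delta_ge hL1 hL2; rewrite -/M.
  have -> : 1 / 32 * eps ^+ 2 * p%:R = eps ^+ 2 * p%:R / 32 by ring.
  have := expR_ge0 (- (eps ^+ 2 * p%:R / 32)).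
  move: (expR (- (eps ^+ 2 * p%:R / 32))) => E E0 h.
  move: (mulr_ge0 M0 eta_i) (eta_i) ri h E0.
  by move: (expR (- (1 / 4096 * _))) (M) => F K; clear; lra.
move=> dpoly k kp.
(* The window length enters the backlog only through its logarithm, so it can be of order
   [Q expR k]. *)
pose L := (Num.truncn (rate D p * (2 * expR k) : R)).+1.
have ek : 0 <= 2 * expR k by rewrite mulr_ge0// expR_ge0.
have /andP[L1 L2] := truncn_itv (mulr_ge0 (le_trans ler01 Q1) ek).
have hL1 : rate D p * (2 * expR k) <= L%:R by exact: ltW.
have hL2 : L%:R <= rate D p * (2 * expR k) + 1 by rewrite -[leLHS]natr1 lerD2r.
have := prob_backlog_le_ln D1 dD1 p1 e0 eps_le draws greedy water fill hB i0 i_ge2 sm L.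
apply: prob_at_least_sub.
  move=> x /= /le_trans; apply.
  exact: (backlog_bound_le p1 D0 eps_ge eps_le dD1 c0 dpoly kp hL2).
have := tail_le p1 D0 dD1 c0 dpoly kp hL1; rewrite -/M2.
move: (expR_ge0 (- expR k)) (mulr_ge0 M20 eta_i) (eta_i) ri.
by move: (expR (- (1 / 4096 * _))) (M2) => F K; clear; lra.
Qed.
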